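(* Let $X$ be an irreducible Fréchet orthoset of rank $\geq 4$. Assume that for any subspace $A$ of $X$, the inclusion map $\iota \colon A \to X$ is adjointable. Then there is an orthomodular space $H$ and an orthoisomorphism between $X$ and $\mathbf P(H)$.
   Context: An orthoset is a set $X$ with a symmetric binary relation $\perp$ and a constant $0$ such that $x\perp x$ if and only if $x=0$, and $0\perp x$ for all $x\in X$. Elements distinct from $0$ are proper. For $A\subseteq X$, $A^\perp=\{x\in X: x\perp y\text{ for all }y\in A\}$; a subspace of $X$ is a subset $A$ with $A=A^{\perp\perp}$, viewed as an orthoset with the inherited relation. The rank of $X$ is the maximal size $n$ of a set of mutually orthogonal proper elements if such a finite maximum exists, and $\infty$ otherwise (rank $\geq 4$ includes rank $\infty$). $X$ is irreducible if $X\setminus\{0\}$ cannot be partitioned into two non-empty subsets that are orthogonal to each other (i.e. each element of one is orthogonal to each element of the other). $X$ is Fréchet if, for any proper elements $x,y\in X$, $\{x\}^\perp\subseteq\{y\}^\perp$ implies $x=y$. A map $f\colon X\to Y$ between orthosets is adjointable if there is a map $g\colon Y\to X$ such that for all $x\in X$, $y\in Y$: $f(x)\perp y$ if and only if $x\perp g(y)$. An orthoisomorphism is a bijection $f\colon X\to Y$ such that $x\perp y$ if and only if $f(x)\perp f(y)$, for all $x,y\in X$. A sfield is a skew field (division ring). A $\ast$-sfield is a sfield $F$ with an involutory antiautomorphism $\ast \colon F \to F$. A Hermitian space over a $\ast$-sfield $F$ is a (left) linear space $H$ over $F$ with a map $(\cdot,\cdot)\colon H\times H\to F$ such that $(\alpha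 u+\beta v,w)=\alpha(u,w)+\beta(v,w)$, $(w,\alpha u+\beta v)=(w,u)\alpha^\ast+(w,v)\beta^\ast$, $(u,v)=(v,u)^\ast$ for all $u,v,w\in H$, $\alpha,\beta\in F$, and which is anisotropic: $(u,u)=0$ implies $u=0$. We write $u\perp v$ if $(u,v)=0$. By standing convention, every Hermitian space is assumed to contain at most countably many mutually orthogonal vectors, that is, every set of mutually orthogonal vectors is at most countable. A linear subspace $S$ of $H$ is orthoclosed if $S=S^{\perp\perp}$, where $S^\perp=\{u\in H:u\perp v\text{ for all }v\in S\}$, and splitting if $H$ is the direct sum of $S$ and $S^\perp$. An orthomodular space is a Hermitian space in which every orthoclosed subspace is splitting. For a Hermitian space $H$, $\mathbf P(H)=\{\langle u\rangle: u\in H\}$ is the set of at most one-dimensional subspaces of $H$ ($\langle u\rangle$ denotes the linear span of $u$), viewed as an orthoset with $\langle u\rangle\perp\langle v\rangle$ if $u\perp v$ and with the zero subspace $\{0\}$ as the constant $0$.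
   Formalization: The convention that H has only countable sets of mutually orthogonal vectors is concluded only when mutually orthogonal sets in X are countable; without this the claim fails, e.g. for X = P(ℓ²(ω₁)). For all other X an orthomodular H is given without the convention. *)

(* Defs.v *)
From mathcomp Require Import all_boot all_algebra.
From mathcomp Require Import boolp classical_sets cardinality.

Set Implicit Arguments.
Unset Strict Implicit.
Unset Printing Implicit Defensive.

Import GRing.Theory.
Local Open Scope classical_set_scope.
Local Open Scope ring_scope.

(** ** Orthogonality relations *)

Definition orthocomplement (T : Type) (r : T -> T -> Prop) (A : set T) : set T :=
  [set x | forall y, A y -> r x y].

Definition mutually_orthogonal (T : Type) (r : T -> T -> Prop) (A : set T) : Prop :=
  forall x y, A x -> A y -> x <> y -> r x y.

Definition countable_orthogonality (T : Type) (r : T -> T -> Prop) : Prop :=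
  forall A : set T, mutually_orthogonal r A -> countable A.

(** ** Orthosets *)

Record orthoset : Type := Orthoset {
  opoint :> Type;
  operp : opoint -> opoint -> Prop;
  ozero : opoint;
  operp_sym : forall x y, operp x y -> operp y x;
  operp_self : forall x, operp x x <-> x = ozero;
  operp_zero : forall x, operp ozero x }.

Arguments operp {o} x y.
Arguments ozero {o}.

Definition proper_elt (X : orthoset) (x : X) : Prop := x <> ozero.

Definition subspace (X : orthoset) (A : set X) : Prop :=
  A = orthocomplement operp (orthocomplement operp A).

Definition proper_orthogonal_set (X : orthoset) (A : set X) : Prop :=
  (forall x, A x -> proper_elt x) /\ mutually_orthogonal operp A.

Definition has_finite_rank (X : orthoset) (n : nat) : Prop :=
  (exists A : set X, proper_orthogonal_set A /\ (A #= `I_n)%card) /\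
  (forall A : set X, proper_orthogonal_set A -> (A #<= `I_n)%card).

(* An orthoset that has no finite rank has rank oo, hence satisfies this for
   every m. *)
Definition rank_at_least (m : nat) (X : orthoset) : Prop :=
  forall n, has_finite_rank X n -> (m <= n)%N.

Definition irreducible (X : orthoset) : Prop :=
  ~ exists A B : set X,
      [/\ A `|` B = [set x | proper_elt x], A `&` B = set0, A !=set0, B !=set0
        & forall x y, A x -> B y -> operp x y].

Definition frechet (X : orthoset) : Prop :=
  forall x y : X, proper_elt x -> proper_elt y ->
    orthocomplement operp [set x] `<=` orthocomplement operp [set y] -> x = y.

Definition adjointable (X Y : orthoset) (f : X -> Y) : Prop :=
  exists g : Y -> X, forall x y, operp (f x) y <-> operp x (g y).

Definition orthoisomorphism (X Y : orthoset) (f : X -> Y) : Prop :=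
  bijective f /\ forall x y, operp x y <-> operp (f x) (f y).

Section SubOrthoset.
Variables (X : orthoset) (A : set X) (hA : subspace A).

Lemma subspace0 : ozero \in A.
Proof. by apply/mem_set; rewrite hA => y _; exact: operp_zero. Qed.

Definition sub_zero : A := exist _ ozero subspace0.

Definition sub_perp (x y : A) : Prop := operp (\val x) (\val y).

Lemma sub_perp_sym x y : sub_perp x y -> sub_perp y x.
Proof. exact: operp_sym. Qed.

Lemma sub_perp_self x : sub_perp x x <-> x = sub_zero.
Proof.
split=> [/operp_self x0|->]; first exact: val_inj.
by apply/operp_self.
Qed.

Lemma sub_perp_zero x : sub_perp sub_zero x.
Proof. exact: operp_zero. Qed.

Definition sub_orthoset : orthoset :=
  Orthoset sub_perp_sym sub_perp_self sub_perp_zero.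

Definition inclusion : sub_orthoset -> X := fun x : A => \val x.

End SubOrthoset.

Arguments inclusion {X A} hA.

(** ** Hermitian spaces *)

(* MathComp has no structure of skew fields: they are the (possibly
   noncommutative) unit rings in which every nonzero element is a unit. *)
Record star_sfield : Type := StarSfield {
  sfield :> unitRingType;
  sfield_unit : forall a : sfield, a != 0 -> a \is a GRing.unit;
  star : sfield -> sfield;
  starD : forall a b, star (a + b) = star a + star b;
  starM : forall a b, star (a * b) = star b * star a;
  starK : involutive star }.

Arguments star {s} a.

(* No bound is put here on the number of mutually orthogonal vectors; that bound
   is [countable_orthogonality (hperp (H := H))]. *)
Record hermitian_space (F : star_sfield) : Type := HermitianSpace {
  hvector :> lmodType F;
  hform : hvector -> hvector -> F;
  hform_linl : forall (a b : F) (u v w : hvector),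
    hform (a *: u + b *: v) w = a * hform u w + b * hform v w;
  hform_linr : forall (a b : F) (u v w : hvector),
    hform w (a *: u + b *: v) = hform w u * star a + hform w v * star b;
  hform_sym : forall u v, hform u v = star (hform v u);
  hform_aniso : forall u, hform u u = 0 -> u = 0 }.

Definition hperp (F : star_sfield) (H : hermitian_space F) (u v : H) : Prop :=
  hform u v = 0.

Definition orthoclosed (F : star_sfield) (H : hermitian_space F) (S : set H) : Prop :=
  submod_closed [in S] /\
  S = orthocomplement (@hperp F H) (orthocomplement (@hperp F H) S).

Definition splitting (F : star_sfield) (H : hermitian_space F) (S : set H) : Prop :=
  (forall v : H, exists s t : H,
      [/\ S s, orthocomplement (@hperp F H) S t & v = s + t]) /\
  S `&` orthocomplement (@hperp F H) S = [set 0].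

Definition orthomodular_space (F : star_sfield) (H : hermitian_space F) : Prop :=
  forall S : set H, orthoclosed S -> splitting S.

(** ** The orthoset of at most one-dimensional subspaces *)

Section Projective.
Variables (F : star_sfield) (H : hermitian_space F).

Definition line (u : H) : set H := [set a *: u | a in [set: F]].

Definition lines : set (set H) := range line.

Definition line_perp (S T : lines) : Prop :=
  exists u v : H, [/\ \val S = line u, \val T = line v & hperp u v].

Lemma line0_in : line 0 \in lines.
Proof. by apply/mem_set; exists 0. Qed.

Definition line_zero : lines := exist _ (line 0) line0_in.

Lemma star0 : star (0 : F) = 0.
Proof. by apply: (addrI (star 0)); rewrite -starD !addr0. Qed.

Lemma hperp_sym (u v : H) : hperp u v -> hperp v u.
Proof. by rewrite /hperp hform_sym => uv0; rewrite -[hform v u]starK uv0 star0. Qed.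

Lemma hform0l (v : H) : hform 0 v = 0.
Proof. by have := hform_linl 0 0 0 0 v; rewrite !scale0r addr0 !mul0r addr0. Qed.

Lemma hformZl (a : F) (u v : H) : hform (a *: u) v = a * hform u v.
Proof. by have := hform_linl a 0 u 0 v; rewrite scale0r addr0 mul0r addr0. Qed.

Lemma hformZr (a : F) (u v : H) : hform v (a *: u) = hform v u * star a.
Proof.
by have := hform_linr a 0 u 0 v; rewrite scale0r addr0 star0 mulr0 addr0.
Qed.

Lemma line_id (u : H) : line u u.
Proof. by exists 1 => //; rewrite scale1r. Qed.

Lemma line_eq_perp (u u' v v' : H) :
  line u = line u' -> line v = line v' -> hperp u v -> hperp u' v'.
Proof.
move=> uu' vv' uv0.
have [a _ <-] : line u u' by rewrite uu'; exact: line_id.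
have [b _ <-] : line v v' by rewrite vv'; exact: line_id.
by rewrite /hperp hformZl hformZr uv0 mul0r mulr0.
Qed.

Lemma line_perp_sym S T : line_perp S T -> line_perp T S.
Proof. by move=> [u [v [Su Tv uv]]]; exists v, u; split=> //; exact: hperp_sym. Qed.

Lemma line_perp_self S : line_perp S S <-> S = line_zero.
Proof.
split=> [[u [v [Su Sv uv]]]|->]; last first.
  by exists 0, 0; split=> //; exact: hform0l.
apply: val_inj; rewrite Su /=; congr line; apply: hform_aniso.
by apply: (line_eq_perp (erefl (line u)) _ uv); rewrite -Sv.
Qed.

Lemma line_perp_zero S : line_perp line_zero S.
Proof.
have [u _ Su] := set_mem (valP S).
by exists 0, u; split=> //; exact: hform0l.
Qed.

Definition projective_orthoset : orthoset :=
  Orthoset line_perp_sym line_perp_self line_perp_zero.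

End Projective.

(* Main.v *)
From HB Require Import structures.
Require Import Defs.
From mathcomp Require Import all_boot all_algebra.
From mathcomp Require Import boolp classical_sets cardinality.

(* Adjointness of the inclusions provides every subspace with a projection, which
   turns the lattice of subspaces into a projective geometry in which each
   orthocomplement of a point is a hyperplane; irreducibility puts a third point on
   every line.  Fix a proper element [o] and take its orthocomplement as hyperplane
   at infinity.  The rank makes Desargues' theorem available, so that the points off
   this hyperplane form an abelian group of translations, on which the
   direction-preserving endomorphisms form a sfield [F].  With [V] this group, the
   points of [X] are the lines of [F * V].  For [v] in [V], the affine part of the
   orthocomplement of [v] is an affine hyperplane, hence the locus where some linear
   functional [form _ v] takes the value -1; the symmetry of orthogonality makes
   [form] Hermitian, and projections of [X] become splittings of orthoclosed
   subspaces. *)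

Set Implicit Arguments.
Unset Strict Implicit.
Unset Printing Implicit Defensive.

Import GRing.Theory.
Local Open Scope ring_scope.
Local Open Scope classical_set_scope.

(** No dimension is at hand, so the geometry is done with closures [hull s] of finite lists, and
    incidences are checked by testing against orthogonal elements. The element [o] has two roles. It
    is the pole of the hyperplane at infinity, and, not being orthogonal to itself, it is also an
    affine point, which becomes the zero of [V]. Hence (1, 0) has to be orthogonal to every (0, v),
    the form on [F * V] has no mixed terms, and orthogonality of (1, x) and (1, v) reads 1 +
    [form x v] = 0: this is the origin of the value -1. Rank 4 enters as the existence of a point
    off any plane, which lifts coplanar configurations into space. *)

Notation "x _|_ y" := (operp x y) (at level 70, no associativity).

(** * Closures of finite lists and orthogonal families *)

Section Hull.
Variable X : orthoset.
Implicit Types (x y z w a b : X) (s t : seq X).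

(** A recursive conjunction, so that [cbn] turns it into separate hypotheses for [hull_tac]. *)
Fixpoint orth s b : Prop := if s is a :: s' then a _|_ b /\ orth s' b else True.

Definition hull s w : Prop := forall b, orth s b -> w _|_ b.

Lemma perpC x y : x _|_ y <-> y _|_ x.
Proof. by split; exact: operp_sym. Qed.

Lemma perpxx x : x _|_ x -> x = ozero.
Proof. by move/operp_self. Qed.

Lemma perp0x x : ozero _|_ x.
Proof. exact: operp_zero. Qed.

Lemma perpx0 x : x _|_ ozero.
Proof. exact/operp_sym/operp_zero. Qed.

Lemma subspace_orthocomplement (A : set X) : subspace (orthocomplement operp A).
Proof.
apply/seteqP; split=> [x Ax y|x Ax y Ay]; first by move=> yA; exact/operp_sym/yA.
by apply: Ax => z zA; exact/operp_sym/zA.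
Qed.

Lemma subspace_orth s : subspace (orth s).
Proof.
apply/seteqP; split=> x; first by move=> sx y yA; exact/operp_sym/yA.
move=> sx; have {sx} : forall y, (forall z, orth s z -> y _|_ z) -> y _|_ x.
  by move=> y yP; apply/operp_sym/sx.
elim: s => [|a s IHs] //= sx; split; first by apply: sx => z [].
by apply: IHs => y ys; apply: sx => z [_ /ys].
Qed.

Lemma subspace_hull s : subspace (hull s).
Proof. exact: subspace_orthocomplement. Qed.

(** If no orthogonal family had more than n elements, one with n elements would make n the finite
    rank, so that m would be at most n. This treats finite and infinite rank alike. *)
Lemma orthogonal_family m : rank_at_least m X -> forall n, (n <= m)%N ->
  exists A : set X, proper_orthogonal_set A /\ (A #= `I_n)%card.
Proof.
move=> hm; elim=> [_|n IHn nm].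
  by exists set0; split; [split|rewrite II0].
have [A [Ao An]] := IHn (ltnW nm).
(* At least n + 1 elements suffice, since a subset of a proper orthogonal set is again one. *)
suff [B [[B0 Bo] /card_subP[C Cn CB]]] :
    exists B : set X, proper_orthogonal_set B /\ (`I_n.+1 #<= B)%card.
  exists C; split=> //; split=> [x /CB|x y /CB Bx /CB By]; [exact: B0|exact: Bo].
apply: contrapT => noB; have : (m <= n)%N; last by rewrite leqNgt nm.
apply: hm; split=> [|B Bo]; first by exists A.
apply: contrapT => nB; apply: noB; exists B; split=> //.
have [/infiniteP|/contrapT/finite_setP[k Bk]] := pselect (infinite_set B).
  by apply: card_le_trans; exact: subset_card_le.
rewrite (card_le_eqr Bk) card_le_II; rewrite (card_le_eql Bk) card_le_II in nB.
by rewrite ltnNge; apply/negP.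
Qed.

Lemma proper_exists m : (0 < m)%N -> rank_at_least m X -> exists x, x <> ozero.
Proof.
move=> m0 hm; have [A [[A0 _] A1]] := orthogonal_family hm m0.
have [x Ax] : (A !=set0)%classic.
  apply/set0P/eqP => AE; move: A1; rewrite AE => /card_esym.
  by rewrite card_eq0 => /eqP/seteqP [/(_ 0%N erefl)].
by exists x; exact: A0.
Qed.

End Hull.

(* Hypotheses are compared syntactically: unification of distinct points of
   the affine part may unfold the group law without end. *)
Ltac syntactic_assumption :=
  match goal with |- ?P =>
    match goal with H : ?Q |- _ => constr_eq P Q; exact H end
  end.

(** Forward chaining: for [b] orthogonal to the generators in the goal, each hypothesis [hull s x]
    whose generators are already known to be orthogonal to [b] adds [x _|_ b]. *)
Ltac hull_tac :=
  let b := fresh "b" in let Hb := fresh "Hb" in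
  repeat match goal with |- hull _ _ -> _ => intro end;
  move=> b Hb; cbn [orth] in Hb;
  repeat match goal with H : _ /\ _ |- _ => destruct H end;
  have ? := @perp0x _ b;
  repeat match goal with H : hull _ ?x |- _ =>
    assert (x _|_ b)
      by (apply H; cbn [orth];
          repeat (first [exact I | syntactic_assumption | split; [syntactic_assumption|]]));
    clear H
  end; syntactic_assumption.

(* [origin] is an arbitrary proper element, whose orthocomplement serves as the
   hyperplane at infinity. *)
Record geometry : Type := Geometry {
  carrier :> orthoset;
  origin : carrier;
  origin_proper : origin <> ozero;
  frechetG : frechet carrier;
  adjointableG : forall (A : set carrier) (hA : subspace A), adjointable (inclusion hA);
  irreducibleG : irreducible carrier;
  rankG : rank_at_least 4 carrier }.

(** * Projections, exchange and modularity *)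

Section Geometry.
Variable G : geometry.
Local Notation X := (carrier G).
Implicit Types (x y z w a b e : X) (s t : seq X).

(** The adjoint of the inclusion is the orthogonal projection on [A], known only through
    orthogonality to elements of [A]. *)
Lemma proj (A : set X) x : subspace A ->
  exists2 y, A y & forall a, A a -> (a _|_ x <-> a _|_ y).
Proof.
move=> hA; have [g gP] := @adjointableG G _ hA.
exists (\val (g x)); first exact/set_mem/(valP (g x)).
by move=> a /mem_set aA; exact: (gP (exist _ a aA) x).
Qed.

(** A test element outside [A] is replaced by its projection on [A]. *)
Lemma frechet_in (A : set X) x y : subspace A -> A x -> A y ->
    x <> ozero -> y <> ozero ->
  (forall a, A a -> a _|_ x -> a _|_ y) -> x = y.
Proof.
move=> hA Ax Ay x0 y0 xy; apply: frechetG => // z /(_ _ erefl) zx _ ->.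
have [u Au uP] := proj z hA.
apply/operp_sym/uP => //; apply/operp_sym/xy => //.
by apply/operp_sym/uP => //; exact/operp_sym.
Qed.

(** [z] is the projection of [y] on the orthocomplement of [s]. *)
Lemma foot s y : ~ hull s y ->
  exists z, [/\ z <> ozero, orth s z & forall a, orth s a -> (a _|_ y <-> a _|_ z)].
Proof.
move=> ys; have [z sz zP] := proj y (@subspace_orth X s).
exists z; split=> // z0; apply: ys => b /zP [_ yb].
by apply/operp_sym/yb; rewrite z0; exact: perpx0.
Qed.

Lemma hull1 x w : hull [:: x] w -> w = ozero \/ w = x.
Proof.
move=> xw; have [->|w0] := pselect (w = ozero); first by left.
have [x0|x0] := pselect (x = ozero).
  by case: w0; apply/perpxx/xw; rewrite x0 /=; split=> //; exact: perp0x.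
right; apply/esym/frechetG => // z /(_ _ erefl) zx _ ->.
by apply/operp_sym/xw; split=> //; exact/operp_sym.
Qed.

(** Both elements have nonzero projections on the orthocomplement of [s]. Within it, whatever is
    orthogonal to that of [x] is orthogonal to that of [y], so the two coincide by the Fréchet
    property, a condition symmetric in [x] and [y]. *)
Lemma exchange s x y : hull (x :: s) y -> ~ hull s y -> hull (y :: s) x.
Proof.
move=> xsy nsy; have nsx : ~ hull s x by move=> sx; apply: nsy; hull_tac.
have [z [z0 sz zP]] := foot nsx; have [z' [z'0 sz' z'P]] := foot nsy.
have zz' : z = z'.
  apply: (frechet_in (@subspace_orth X s)) => // a sa az.
  by apply/z'P => //; apply/operp_sym/xsy; split=> //; apply/operp_sym/zP.
by move=> b [/operp_sym yb sb]; apply/operp_sym/zP => //; rewrite zz'; exact/z'P.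
Qed.

(** The orthomodular law for one added point: otherwise the projection of [a] on the orthocomplement
    of [s] would be [z], and [a _|_ z] would give [z _|_ z]. *)
Lemma hull_hyper s z a : z <> ozero -> orth s z -> hull (z :: s) a -> a _|_ z ->
  hull s a.
Proof.
move=> z0 sz zsa az; apply: contrapT => nsa.
have [u [u0 su uP]] := foot nsa.
have zu : z = u.
  apply: (frechet_in (@subspace_orth X s)) => // b sb bz.
  by apply/uP => //; apply/operp_sym/zsa; split=> //; exact/operp_sym.
by apply: z0; apply: perpxx; rewrite {2}zu; apply/uP => //; apply/operp_sym.
Qed.

Lemma line_perp_point x w : ~ hull [:: x] w ->
  exists z, [/\ z <> ozero, hull [:: x; w] z, z _|_ x & hull [:: x; z] w].
Proof.
move=> xw; have [z [z0 [xz _] zP]] := foot xw.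
exists z; split=> //.
- by move=> b [xb [wb _]]; apply/operp_sym/zP; [split=> //|]; exact/operp_sym.
- exact: operp_sym.
- by move=> b [xb [zb _]]; apply/operp_sym/zP; [split=> //|]; exact/operp_sym.
Qed.

(** On the line, orthogonality to [z] is orthogonality to the projection [u] of [z]. As [u] lies on
    the line itself, [line_perp_point] applies within it. *)
Lemma line_hyperplane x w z : x <> ozero -> ~ hull [:: x] w ->
  exists a, [/\ a <> ozero, hull [:: x; w] a & a _|_ z].
Proof.
move=> x0 xw; have [u Lu uP] := proj z (subspace_hull [:: x; w]).
have Lx : hull [:: x; w] x by hull_tac.
have [u0|u0] := pselect (u = ozero).
  by exists x; split=> //; apply/uP => //; rewrite u0; exact: perpx0.
suff [a [a0 La au]] : exists a, [/\ a <> ozero, hull [:: x; w] a & a _|_ u].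
  by exists a; split=> //; exact/uP.
have [ux|ux] := pselect (hull [:: u] x); last first.
  by have [a [a0 La au _]] := line_perp_point ux; exists a; split=> //; hull_tac.
have [//|xu] := hull1 ux.
by have [a [a0 La au _]] := line_perp_point xw; exists a; split=> //; rewrite -xu.
Qed.

(** With [z] the foot of [x], [hull (x :: s)] and [hull (z :: s)] agree, and [hull s] is the part
    orthogonal to [z]. The line [x w] meets the orthocomplement of [z], and the meeting point is
    [a]. *)
Lemma modular s x w : hull (x :: s) w -> exists2 a, hull s a & hull [:: x; a] w.
Proof.
move=> xsw; have [xw|xw] := pselect (hull [:: x] w).
  by exists ozero; [hull_tac | hull_tac].
have [sx|sx] := pselect (hull s x); first by exists w; hull_tac.
have [z [z0 sz zP]] := foot sx.
have x0 : x <> ozero by move=> x0; apply: sx; rewrite x0 => b _; exact: perp0x.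
have [a [a0 La az]] := line_hyperplane z x0 xw.
have sa : hull s a.
  apply: (hull_hyper z0 sz) => // b [zb sb]; apply: La; split=> //=.
    by apply/operp_sym/zP => //; exact/operp_sym.
  split=> //; apply: xsw; split=> //; apply/operp_sym/zP => //; exact/operp_sym.
exists a => //.
have wxa : hull [:: w; x] a by hull_tac.
suff /(exchange wxa) : ~ hull [:: x] a by hull_tac.
by move=> /hull1 [//|ax]; apply: sx; rewrite -ax.
Qed.

Lemma hull2_eq x y p q : x <> ozero -> ~ hull [:: x] y ->
  hull [:: p; q] x -> hull [:: p; q] y -> hull [:: x; y] p /\ hull [:: x; y] q.
Proof.
move=> x0 xy px py.
have nx0 : ~ hull [::] x by move=> /(_ x I)/perpxx.
have [qx|qx] := pselect (hull [:: q] x).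
  have [//|xq] := hull1 qx; rewrite -{}xq in px py *; split; last by hull_tac.
  by have := exchange py xy; hull_tac.
have pL : hull [:: x; q] p by exact: exchange.
have yL : hull [:: q; x] y by hull_tac.
have := exchange yL xy => H; split; hull_tac.
Qed.

(** ** Lines through two points *)

(** Sharing a non-orthogonal element with [x] passes along non-orthogonality, so irreducibility
    extends it to all proper elements. *)
Lemma common_nonorthogonal x y : x <> ozero -> y <> ozero ->
  exists a, ~ a _|_ x /\ ~ a _|_ y.
Proof.
move=> x0 y0; apply: contrapT => nxy.
have nxx z : z <> ozero -> ~ z _|_ z by move=> z0 /perpxx.
(* The chain [x], [a], [b], [y'] is shortened: if neither [a] nor [b] serves, another point [c] of
   their line does, since its orthogonality to [x] or to [y'] would spread over the whole line. *)
have chain a b y' : ~ a _|_ x -> ~ b _|_ a -> ~ b _|_ y' ->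
    exists c, ~ c _|_ x /\ ~ c _|_ y'.
  move=> ax ba bY.
  have [bx|bx] := pselect (b _|_ x); last by exists b.
  have [aY|aY] := pselect (a _|_ y'); last by exists a.
  have a0 : a <> ozero by move=> a0; apply: ax; rewrite a0; exact: perp0x.
  have nab : ~ hull [:: a] b.
    by move=> /hull1 [b0|eab]; [apply: bY; rewrite b0; exact: perp0x|apply: ax; rewrite -eab].
  have [c [c0 Lc ca Lb]] := line_perp_point nab; exists c; split.
    move=> cx; apply: ax.
    have nbc : ~ hull [:: b] c.
      by move=> /hull1 [//|cb]; apply: ba; rewrite -cb.
    have b0 : b <> ozero by move=> b0; apply: ba; rewrite b0; exact: perp0x.
    have Lb' : hull [:: a; b] b by hull_tac.
    have [Ha _] := hull2_eq b0 nbc Lb' Lc.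
    by apply: Ha.
  by move=> cY; apply: bY; apply: Lb.
apply: (@irreducibleG G).
exists [set z | z <> ozero /\ exists a, ~ a _|_ x /\ ~ a _|_ z]%classic,
  [set z | z <> ozero /\ ~ exists a, ~ a _|_ x /\ ~ a _|_ z]%classic.
split.
- apply/seteqP; split=> z; first by move=> [[]|[]].
  by move=> z0; have [h|h] := pselect (exists a, ~ a _|_ x /\ ~ a _|_ z); [left|right].
- by apply/seteqP; split=> z // [[_ h] [_ /(_ h)]].
- by exists x; split=> //; exists x; split; exact: nxx.
- by exists y.
move=> u v [u0 [a [ax au]]] [v0 nv]; apply: contrapT => uv; apply: nv.
apply: (chain _ _ _ ax) uv; exact/contra_not/au/operp_sym.
Qed.

(** If [x _|_ y], the line receives its third point as projection of a common non-orthogonal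
    element; otherwise the point of the line orthogonal to [x] serves. *)
Lemma third_point x y : x <> ozero -> y <> ozero -> x <> y ->
  exists w, [/\ hull [:: x; y] w, w <> ozero, w <> x & w <> y].
Proof.
move=> x0 y0 xy; have [xPy|xNy] := pselect (x _|_ y).
  have [a [ax ay]] := common_nonorthogonal x0 y0.
  have [w Lw wP] := proj a (subspace_hull [:: x; y]).
  have Lx : hull [:: x; y] x by hull_tac.
  have Ly : hull [:: x; y] y by hull_tac.
  exists w; split=> // ew; [apply: ax|apply: ay|apply: ax]; apply/operp_sym/wP => //.
  - by rewrite ew; exact: perpx0.
  - by rewrite ew; exact/operp_sym.
  - by rewrite ew.
have nxy : ~ hull [:: x] y by move=> /hull1 [//|/esym].
have [w [w0 Lw wx _]] := line_perp_point nxy; exists w; split=> // ew; subst w.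
  by apply: x0; exact: perpxx.
by apply: xNy; exact/operp_sym.
Qed.

(** * Bounding orthogonal families in finite closures *)

Lemma orth_cat s t b : orth (s ++ t) b <-> orth s b /\ orth t b.
Proof. by elim: s => /= [|a s ->]; [tauto | tauto]. Qed.

(** [s'] is [s] with [x] removed; the implication between [orth] conditions says so without
    reordering lists. *)
Lemma steinitz_swap s t e : hull (s ++ t) e -> ~ hull t e ->
  exists x s', [/\ size s = (size s').+1,
    forall b, orth s' b -> x _|_ b -> orth s b & hull (s' ++ e :: t) x].
Proof.
elim: s => [//|x s IHs] xse nte.
have [se|nse] := pselect (hull (s ++ t) e).
  have [y [s' [ss' sP s'y]]] := IHs se nte.
  exists y, (x :: s'); split=> /=; first by rewrite ss'.
    by move=> b [xb s'b] yb; split=> //; exact: sP.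
  by move=> b [_ /s'y].
exists x, s; split=> //= b; rewrite orth_cat => -[sb [eb tb]].
by apply: (exchange xse nse); split=> //; apply/orth_cat.
Qed.

(** [t] collects the elements already exchanged in. As [f n] is orthogonal to [t], it is not in
    [hull t], so it can replace a member of [s]. *)
Lemma orthogonal_bound n s t (f : nat -> X) :
    (forall i, (i < n)%N -> f i <> ozero) ->
    (forall i j, (i < n)%N -> (j < n)%N -> i <> j -> f i _|_ f j) ->
    (forall i, (i < n)%N -> orth t (f i)) ->
  (forall i, (i < n)%N -> hull (s ++ t) (f i)) -> (n <= size s)%N.
Proof.
elim: n s t => // n IHn s t f0 fo tf sf.
have ntf : ~ hull t (f n).
  by move=> /(_ _ (tf n (ltnSn n))); move/perpxx; exact: f0.
have [x [s' [-> sP s'x]]] := steinitz_swap (sf n (ltnSn n)) ntf.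
rewrite ltnS; apply: (IHn s' (f n :: t)).
- by move=> i /ltnW; exact: f0.
- by move=> i j /ltnW ? /ltnW ?; exact: fo.
- move=> i iltn; split; last exact/tf/ltnW.
  by apply: fo => //; [exact: ltnW | move=> ni; rewrite ni ltnn in iltn].
- move=> i /ltnW iltn b sb; apply: sf => //; apply/orth_cat.
  have xb := s'x b sb; move: sb; rewrite orth_cat => -[s'b [_ tb]].
  by split=> //; exact: sP.
Qed.

Lemma point_off_plane : forall a b c, exists x, ~ hull [:: a; b; c] x.
Proof.
move=> a b c; apply: contrapT => nx.
have hullT x : hull [:: a; b; c] x by apply: contrapT => hx; apply: nx; exists x.
pose Xp : pointedType :=
  HB.pack (opoint X) (gen_eqMixin X) (gen_choiceMixin X) (isPointed.Build X ozero).
have [A [[A0 Ao] /card_esym/(@card_set_bijP _ Xp)[f [fA finj _]]]] := orthogonal_family (@rankG G) (leqnn 4).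
suff: (4 <= 3)%N by [].
apply: (@orthogonal_bound 4 [:: a; b; c] [::] f) => //.
- by move=> i i4; apply: A0; exact: fA.
- move=> i j i4 j4 ij; apply: Ao; [exact: fA|exact: fA|] => fij; apply: ij.
  by apply: finj => //; exact/mem_set.
Qed.

End Geometry.

(** * Affine part *)

Definition affine (G : geometry) : Type := {x : G | ~ x _|_ origin G}.

Coercion affine_point (G : geometry) (p : affine G) : G := sval p.

Section Affine.
Variable G : geometry.
Local Notation X := (carrier G).
Local Notation o := (origin G).
Implicit Types (x y z w a b e f c : X) (s t : seq X) (p q r : affine G).

Lemma affineP p : ~ p _|_ o. Proof. exact: (svalP p). Qed.

Lemma affine_inj p q : p = q :> X -> p = q.
Proof. by case: p q => p pP [q qP] /= pq; exact: eq_exist. Qed.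

Lemma affine_proper p : p <> ozero :> X.
Proof. by move=> p0; apply: (@affineP p); rewrite p0; exact: perp0x. Qed.

Lemma hull1_proper x y : y <> ozero -> y <> x -> ~ hull [:: x] y.
Proof. by move=> y0 yx /hull1[]. Qed.

Lemma affine_hull1 p q : p <> q -> ~ hull [:: (p : X)] q.
Proof. by move=> pq /hull1[/affine_proper|/affine_inj/esym]. Qed.

(** Adjoining an affine point adds nothing at infinity: otherwise an exchange would place [p] in the
    closure of points at infinity. *)
Lemma hyper_hull p s y : orth s o -> y _|_ o -> hull ((p : X) :: s) y -> hull s y.
Proof.
move=> so yo psy; have [a sa pay] := modular psy.
have [ay|ay] := pselect (hull [:: a] y); first by hull_tac.
have pya : hull [:: y; a] p by apply: exchange.
by case: (@affineP p); apply: pya; split=> //; split=> //; exact: sa.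
Qed.

Lemma dir_exists p q : exists e,
  [/\ e _|_ o, hull [:: (p : X); (q : X)] e & e = ozero <-> p = q].
Proof.
have [->|pq] := pselect (p = q).
  by exists ozero; split=> //; [exact: perp0x | hull_tac].
have [e [e0 pqe eo]] := line_hyperplane o (@affine_proper p) (affine_hull1 pq).
by exists e; split.
Qed.

(* The point at infinity of the line [pq], and [ozero] if [p = q]. *)
Definition dir p q : X := projT1 (cid (dir_exists p q)).

Lemma dir_orth p q : dir p q _|_ o.
Proof. by rewrite /dir; case: cid => ? []. Qed.

Lemma dir_hull p q : hull [:: (p : X); (q : X)] (dir p q).
Proof. by rewrite /dir; case: cid => ? []. Qed.

Lemma dir_eq0 p q : dir p q = ozero <-> p = q.
Proof. by rewrite /dir; case: cid => ? []. Qed.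

Global Opaque dir.

Lemma dirxx p : dir p p = ozero. Proof. exact/dir_eq0. Qed.

(** Two distinct points at infinity would span the line and leave no affine point on it. *)
Lemma hyper_eq p x e f : hull [:: (p : X); x] e -> hull [:: (p : X); x] f ->
  e _|_ o -> f _|_ o -> e <> ozero -> f <> ozero -> e = f.
Proof.
move=> Le Lf eo fo e0 f0; apply: contrapT => ef.
have nef : ~ hull [:: e] f by apply: hull1_proper => // fe; exact: ef.
by have [Hp _] := hull2_eq e0 nef Le Lf; apply: (@affineP p); apply: Hp.
Qed.

Lemma dir_unique p q e : hull [:: (p : X); (q : X)] e -> e _|_ o -> e <> ozero ->
  dir p q = e.
Proof.
move=> Le eo e0; apply: (hyper_eq (@dir_hull p q)) => //; first exact: dir_orth.
move=> /dir_eq0 pq; rewrite pq in Le.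
have {}Le : hull [:: (q : X)] e by hull_tac.
by have [//|eq] := hull1 Le; apply: (@affineP q); rewrite -eq.
Qed.

Lemma dir_uniqueR p q e : p <> q -> hull [:: (p : X); e] q -> e _|_ o -> dir p q = e.
Proof.
move=> pq Lq eo; have nq := affine_hull1 pq.
apply: dir_unique => //.
  have Lq' : hull [:: e; (p : X)] q by hull_tac.
  by have := exchange Lq' nq; hull_tac.
by move=> e0; apply: nq; rewrite e0 in Lq; hull_tac.
Qed.

Lemma dirC p q : dir p q = dir q p.
Proof.
have [->//|pq] := pselect (p = q).
apply: dir_unique; [|exact: dir_orth|by move=> /dir_eq0/esym].
by have := @dir_hull q p; hull_tac.
Qed.

Lemma dir_hullR p q : hull [:: (p : X); dir p q] q.
Proof.
have [->|pq] := pselect (p = q); first by hull_tac.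
have nd : ~ hull [:: (p : X)] (dir p q).
  apply: hull1_proper; first by move=> /dir_eq0.
  by move=> E; apply: (@affineP p); rewrite -E; exact: dir_orth.
have Lq : hull [:: (q : X); (p : X)] (dir p q) by have := @dir_hull p q; hull_tac.
by have := exchange Lq nd; hull_tac.
Qed.

Lemma dir_eq_hull p q r : p <> q -> hull [:: (p : X); (r : X)] q -> dir p q = dir p r.
Proof.
move=> pq Lq; apply: dir_uniqueR => //; last exact: dir_orth.
by have := @dir_hullR p r; hull_tac.
Qed.

Lemma dir_eq_hullR p q r : dir p q = dir p r -> hull [:: (p : X); (q : X)] r.
Proof. by move=> E; have := @dir_hullR p r; rewrite -E; have := @dir_hull p q; hull_tac. Qed.

(** If [r] and [r'] differed, their directions from [p] and from [q] would both be the direction of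
    the line [r r']. *)
Lemma affine_unique p q r r' : dir p r = dir p r' -> dir q r = dir q r' ->
  dir p r <> dir q r -> r = r'.
Proof.
move=> pE qE pq; apply: contrapT => rr'.
suff H (s : affine G) : dir s r = dir s r' -> dir s r = dir r r' by apply: pq; rewrite (H p pE) (H q qE).
move=> sE; have [sr|sr] := pselect (dir s r = ozero).
  have sr' := sr; rewrite sE in sr'.
  by move/dir_eq0: sr => sr; move/dir_eq0: sr' => sr'; case: rr'; rewrite -sr.
apply/esym/dir_unique => //; last exact: dir_orth.
have Lr := @dir_hullR s r; have Lr' := @dir_hullR s r'; rewrite -sE in Lr'.
by have [] := hull2_eq (@affine_proper r) (affine_hull1 rr') Lr Lr'.
Qed.

(** For [x] at infinity this is a third point of the line, and so rests on irreducibility. *)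
Lemma affine_on_line p x : x <> ozero -> x <> p :> X ->
  exists r, r <> p /\ hull [:: (p : X); x] r.
Proof.
move=> x0 xp; have [xo|xo] := pselect (x _|_ o); last first.
  exists (exist _ x xo); split; last by rewrite /=; hull_tac.
  by move=> /(congr1 (@affine_point G)) /= E; apply: xp.
have [w [Lw w0 wp wx]] := third_point (@affine_proper p) x0 (nesym xp).
have wo : ~ w _|_ o.
  move=> wo; apply: wx; apply: (hyper_eq Lw) => //; hull_tac.
exists (exist _ w wo); split=> // /(congr1 (@affine_point G)) /= E; exact: wp.
Qed.

Lemma affine_off_plane p x y : exists r, ~ hull [:: (p : X); x; y] r.
Proof.
have [z nz] := point_off_plane p x y.
have z0 : z <> ozero by move=> z0; apply: nz; rewrite z0; hull_tac.
have zp : z <> p :> X by move=> zp; apply: nz; rewrite zp; hull_tac.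
have [r [rp Lr]] := affine_on_line z0 zp; exists r => Pr; apply: nz.
have Lr' : hull [:: z; (p : X)] r by hull_tac.
by have := exchange Lr' (affine_hull1 (nesym rp)); hull_tac.
Qed.

End Affine.

(** * Central collineations *)

Section Perspectivity.
Variable G : geometry.
Local Notation X := (carrier G).
Local Notation o := (origin G).
Implicit Types (b d p q r x y z : affine G).
Variable c : X.

(** [q'] is the image of [q] under the collineation with centre [c] that takes [p] to [p']. The
    centre may be affine or at infinity, so homotheties and translations are constructed
    together. *)
Definition persp p p' q q' : Prop :=
  [/\ hull [:: c; (p : X)] p', hull [:: c; (q : X)] q', ~ hull [:: c; (p : X)] q,
      p' <> c :> X /\ q' <> c :> X & dir p q = dir p' q'].

Lemma ray_sym p p' : hull [:: c; (p : X)] p' -> p' <> c :> X -> hull [:: c; (p' : X)] p.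
Proof.
move=> Lp pc; have Lp' : hull [:: (p : X); c] p' by hull_tac.
by have := exchange Lp' (hull1_proper (@affine_proper _ p') pc); hull_tac.
Qed.

Lemma ray_not p p' q : hull [:: c; (p : X)] p' -> p' <> c :> X ->
  ~ hull [:: c; (p : X)] q -> ~ hull [:: c; (q : X)] p'.
Proof.
move=> Lp pc nq Lq; apply: nq.
by have := ray_sym Lq pc; hull_tac.
Qed.

(** The image is the intersection of the line [c q] with the parallel to [p q] through [p']. *)
Lemma persp_exists p p' q : hull [:: c; (p : X)] p' -> p' <> c :> X ->
  ~ hull [:: c; (p : X)] q -> exists q', persp p p' q q'.
Proof.
move=> Lp pc nq; have qp' := ray_not Lp pc nq.
have Lq := @dir_hullR _ p q; have Lp0 := @dir_hullR _ q p.
have e0 : dir p q <> ozero by move=> /dir_eq0 pq; apply: nq; rewrite pq; hull_tac.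
have H : hull [:: dir p q; c; (q : X)] p' by rewrite dirC; hull_tac.
have [x' Lx' Lp'] := modular H.
have x'o : ~ x' _|_ o.
  move=> x'o; apply: (@affineP _ p'); apply: Lp'.
  by split=> //; exact: dir_orth.
pose q' : affine G := exist _ x' x'o; rewrite -[x']/(affine_point q') in Lx' Lp'.
exists q'; split=> //.
- split=> // q'c; apply: nq; rewrite q'c in Lp'.
  by have := exchange Lp' (hull1_proper (@affine_proper _ p') pc); hull_tac.
- apply/esym/dir_unique=> //; last exact: dir_orth.
  have npq : p' <> q' by move=> pq; rewrite -pq in Lx'.
  by have := exchange Lp' (affine_hull1 (nesym npq)); hull_tac.
Qed.

Lemma persp_sym p p' q q' : persp p p' q q' -> persp q q' p p'.
Proof.
case=> Lp Lq nq [pc qc] E; split=> //; last by rewrite dirC E dirC.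
move=> H; apply: nq.
have pc' : p <> c :> X.
  move=> pE; rewrite pE in Lp; have {}Lp : hull [:: c] p' by hull_tac.
  by case/hull1: Lp => // /affine_proper.
by have := ray_sym H pc'; hull_tac.
Qed.

(* Desargues' theorem for two triangles that are in perspective from [c] and
   span a plane not containing [c]: the points at infinity of [qr] and [q'r']
   both lie on the line at infinity of the plane [pqr]. *)
Lemma persp_desargues p p' q q' r r' : persp p p' q q' -> persp p p' r r' ->
  ~ hull [:: c; (p : X); (q : X)] r -> dir q r = dir q' r'.
Proof.
move=> Pq Pr nr.
have [_ _ np [_ _] _] := persp_sym Pq.
have [Lp Lq nq [pc qc] Eq] := Pq; have [_ Lr nr1 [_ rc] Er] := Pr.
apply: contrapT => ne.
have qr : q <> r by move=> qr; apply: nr; rewrite qr; hull_tac.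
have nqr : ~ hull [:: c; (q : X)] r by move=> H; apply: nr; hull_tac.
have qr' : q' <> r'.
  by move=> qr'; apply: (ray_not Lq qc nqr); rewrite qr'.
have H1 : hull [:: dir p q; dir p r] (dir q r).
  apply: (@hyper_hull _ p); [by split; [|split=> //]; exact: dir_orth|exact: dir_orth|].
  have := @dir_hull _ q r; have := @dir_hullR _ p q; have := @dir_hullR _ p r; hull_tac.
have H2 : hull [:: dir p q; dir p r] (dir q' r').
  apply: (@hyper_hull _ p'); [by split; [|split=> //]; exact: dir_orth|exact: dir_orth|].
  rewrite Eq Er.
  have := @dir_hull _ q' r'; have := @dir_hullR _ p' q'; have := @dir_hullR _ p' r'; hull_tac.
have d0 : dir q r <> ozero by move/dir_eq0.
have d0' : dir q' r' <> ozero by move/dir_eq0.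
have [H _] := hull2_eq d0 (hull1_proper d0' (nesym ne)) H1 H2.
have H3 : hull [:: c; (q : X); (r : X)] (dir p q).
  have := @dir_hull _ q r; have := @dir_hull _ q' r'; hull_tac.
have H4 : hull [:: (r : X); c; (q : X)] p.
  have := @dir_hullR _ q p; rewrite dirC; hull_tac.
by apply: nr; have := exchange H4 np; hull_tac.
Qed.

Lemma persp_dir p p' q q' r r' : persp p p' q q' -> persp p p' r r' ->
  dir q r = dir q' r'.
Proof.
have trans (s s' t t' u u' : affine G) : persp s s' t t' -> persp s s' u u' ->
    ~ hull [:: c; (s : X); (t : X)] u -> persp t t' u u'.
  move=> Pt Pu nu; have D := persp_desargues Pt Pu nu.
  case: Pt Pu => _ Lt _ [_ tc] _ [_ Lu _ [_ uc] _].
  by split=> // H; apply: nu; hull_tac.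
move=> Pq Pr.
have [Lp Lq nq [pc qc] Eq] := Pq; have [_ Lr nr [_ rc] Er] := Pr.
have [npl|pl] := pselect (hull [:: c; (p : X); (q : X)] r); last exact: (persp_desargues Pq Pr).
have [nqr|nqr] := pselect (hull [:: c; (q : X)] r); last first.
  (* A point off the plane reduces the coplanar case to [persp_desargues]. *)
  have [s ns] := affine_off_plane p q c.
  have nps : ~ hull [:: c; (p : X)] s by move=> H; apply: ns; hull_tac.
  have [s' Ps] := persp_exists Lp pc nps.
  have Pqs : persp q q' s s' by apply: (trans p p') => // H; apply: ns; hull_tac.
  have Prs : persp r r' s s' by apply: (trans p p') => // H; apply: ns; hull_tac.
  apply: (persp_desargues (persp_sym Pqs) (persp_sym Prs)) => H.
  have H' : hull [:: (s : X); c; (q : X)] r by hull_tac.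
  by apply: ns; have := exchange H' nqr; hull_tac.
(* There remains [r] on the line [c q]. Both directions are then the point at infinity of this line,
   unless exactly one of the pairs [q], [r] and [q'], [r'] collapses, which is excluded here. *)
have line_inj (s t u : affine G) : dir s t = dir s u -> t <> u ->
    hull [:: c; (t : X)] u -> hull [:: c; (t : X)] s.
  move=> E tu Lu; have L1 := @dir_hullR _ s t; have L2 := @dir_hullR _ s u.
  rewrite -E in L2.
  by have [H _] := hull2_eq (@affine_proper _ t) (affine_hull1 tu) L1 L2; hull_tac.
have [qr|qr] := pselect (q = r).
  suff -> : q' = r' by rewrite qr !dirxx.
  apply: contrapT => qr'; apply: (ray_not Lp pc nq).
  have Lqr : hull [:: c; (q' : X)] r'.
    by have := ray_sym Lq qc; rewrite -qr in Lr; hull_tac.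
  by have := line_inj p' q' r'; rewrite -Eq -Er qr => /(_ erefl qr' Lqr); rewrite -qr; hull_tac.
have qr' : q' <> r'.
  move=> qr'; have [_ _ np _ _] := persp_sym Pq; apply: np.
  by apply: (line_inj p q r) => //; rewrite Eq Er qr'.
have Lqc : hull [:: (q : X); c] q' by hull_tac.
have L1 : hull [:: (q : X); c] (dir q r) by have := @dir_hull _ q r; hull_tac.
have L2 : hull [:: (q : X); c] (dir q' r') by have := @dir_hull _ q' r'; hull_tac.
by apply: (hyper_eq L1 L2); try exact: dir_orth; move/dir_eq0.
Qed.

Lemma persp_trans p p' q q' r r' : persp p p' q q' -> persp p p' r r' ->
  ~ hull [:: c; (q : X)] r -> persp q q' r r'.
Proof.
move=> Pq Pr nqr; have D := persp_dir Pq Pr.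
by case: Pq Pr => _ Lt _ [_ tc] _ [_ Lu _ [_ uc] _].
Qed.

Lemma ray_disjoint p q r : ~ hull [:: c; (p : X)] q -> r <> c :> X ->
  hull [:: c; (p : X)] r -> hull [:: c; (q : X)] r -> False.
Proof.
move=> npq rc Lp Lq; apply: npq.
by have := ray_sym Lq rc; hull_tac.
Qed.

(* The bases [p], [q], [r] lie on independent lines through [c], so that any two
   points other than [c] avoid one of these lines, and the images of both can be
   constructed from the same base. *)
Lemma central_collineation p p' : hull [:: c; (p : X)] p' -> p <> c :> X -> p' <> c :> X ->
  exists s : affine G -> affine G, [/\ forall x y, dir (s x) (s y) = dir x y,
    forall x, hull [:: c; (x : X)] (s x) & s p = p'].
Proof.
move=> Lp pc pc'.
have [q nq] := affine_off_plane p c c.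
have {}nq : ~ hull [:: c; (p : X)] q by move=> H; apply: nq; hull_tac.
have [r nr] := affine_off_plane p q c.
have npr : ~ hull [:: c; (p : X)] r by move=> H; apply: nr; hull_tac.
have nqr : ~ hull [:: c; (q : X)] r by move=> H; apply: nr; hull_tac.
have [q' Pq] := persp_exists Lp pc' nq; have [r' Pr] := persp_exists Lp pc' npr.
have Pqr := persp_trans Pq Pr nqr.
pose B b b' := [\/ b = p /\ b' = p', b = q /\ b' = q' | b = r /\ b' = r'].
have Bpersp b b' d d' : B b b' -> B d d' -> (b = d /\ b' = d') \/ persp b b' d d'.
  have Pq' := persp_sym Pq; have Pr' := persp_sym Pr; have Pqr' := persp_sym Pqr.
  move=> [] [-> ->] [] [-> ->]; by [left|right].
have Bray b b' : B b b' -> hull [:: c; (b : X)] b' /\ b' <> c :> X.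
  by move=> [] [-> ->]; [|case: Pq => _ ? _ [] | case: Pr => _ ? _ []].
have Boff x y : x <> c :> X -> y <> c :> X -> exists b b',
    [/\ B b b', ~ hull [:: c; (b : X)] x & ~ hull [:: c; (b : X)] y].
  move=> xc yc.
  have D := ray_disjoint.
  have [xp|xp] := pselect (hull [:: c; (p : X)] x);
  have [yp|yp] := pselect (hull [:: c; (p : X)] y);
  have [xq|xq] := pselect (hull [:: c; (q : X)] x);
  have [yq|yq] := pselect (hull [:: c; (q : X)] y);
  try (by exists p, p'; split=> //; constructor);
  try (by exists q, q'; split=> //; constructor);
  exists r, r'; split; try (by constructor);
  move=> H; (try by apply: (D p r _ npr _ _ H)); (try by apply: (D q r _ nqr _ _ H));
  (try by apply: (D p q _ nq _ _ xq)); by apply: (D p q _ nq _ _ yq).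
(* Quantifying over all admissible bases makes the image independent of the base used; the centre,
   when affine, is fixed. *)
pose im (x x' : affine G) := (x = c :> X /\ x' = x) \/
  [/\ x <> c :> X, hull [:: c; (x : X)] x' &
     forall b b', B b b' -> ~ hull [:: c; (b : X)] x -> persp b b' x x'].
have im_ex x : exists x', im x x'.
  have [xc|xc] := pselect (x = c :> X); first by exists x; left.
  have [b [b' [Bb nb _]]] := Boff x x xc xc.
  have [Lb bc] := Bray _ _ Bb.
  have [x' Px] := persp_exists Lb bc nb; exists x'; right; split=> //.
    by case: Px.
  move=> d d' Bd nd; have [[<- <-]//|Pd] := Bpersp _ _ _ _ Bb Bd.
  exact: persp_trans Px _.
have im_dir x x' y y' : im x x' -> im y y' -> dir x' y' = dir x y.
  move=> [[xc ->]|[xc Lx Px]] [[yc ->]|[yc Ly Py]] //.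
  - have [b [b' [Bb _ /(Py _ _ Bb) [_ _ _ [_ yc'] _]]]] := Boff y y yc yc.
    apply: dir_eq_hull; first by move=> xy; apply: yc'; rewrite -xy.
    by rewrite xc.
  - have [b [b' [Bb _ /(Px _ _ Bb) [_ _ _ [_ xc'] _]]]] := Boff x x xc xc.
    rewrite dirC (dirC x); apply: dir_eq_hull; first by move=> xy; apply: xc'; rewrite -xy.
    by rewrite yc.
  - have [b [b' [Bb /(Px _ _ Bb) Pbx /(Py _ _ Bb) Pby]]] := Boff x y xc yc.
    by rewrite (persp_dir Pbx Pby).
exists (fun x => projT1 (cid (im_ex x))); split.
- by move=> x y; case: cid => x' /= imx; case: cid => y' /= imy; exact: im_dir.
- by move=> x; case: cid => x' /= [[xc ->]|[_ ]//]; hull_tac.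
case: cid => x' /= [[/pc//]|[_ _ Px]].
have [_ _ np _ _] := persp_sym Pq.
have Bq : B q q' by constructor.
have := persp_dir (Px _ _ Bq np) (persp_sym Pq).
by rewrite dirxx => /esym/dir_eq0.
Qed.

End Perspectivity.

(** * Homotheties and translations *)

Section Dilatations.
Variable G : geometry.
Local Notation X := (carrier G).
Local Notation o := (origin G).
Implicit Types (b d p q r x y z : affine G).

Lemma origin_affine : ~ o _|_ o. Proof. by move=> /perpxx; exact: origin_proper. Qed.

Definition aorigin : affine G := exist _ o origin_affine.

Lemma homothety_exists p p' : p <> aorigin -> p' <> aorigin ->
  dir aorigin p = dir aorigin p' ->
  exists s : affine G -> affine G,
    [/\ forall x y, dir (s x) (s y) = dir x y, s aorigin = aorigin & s p = p'].
Proof.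
move=> po po' E.
have Lp : hull [:: o; (p : X)] p' by apply: dir_eq_hullR E.
have [||s [sd sL sp]] := @central_collineation G o p p' Lp.
- by move=> /(@affine_inj G p aorigin).
- by move=> /(@affine_inj G p' aorigin).
exists s; split=> //; apply: affine_inj.
have H : hull [:: o] (s aorigin) by have := sL aorigin; rewrite /=; hull_tac.
by have [/affine_proper|] := hull1 H.
Qed.

(** The centre is the point at infinity of [p q]. A fixed point would fix everything off its line
    through the centre, and with a second such line also [p]; so [dir x (s x)] never degenerates to
    [ozero]. *)
Lemma translation_exists p q : p <> q ->
  exists s : affine G -> affine G,
    [/\ forall x y, dir (s x) (s y) = dir x y, forall x, dir x (s x) = dir p q & s p = q].
Proof.
move=> pq; set c := dir p q.
have co : c _|_ o by exact: dir_orth.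
have c0 : c <> ozero by move=> /dir_eq0.
have neqc (r : affine G) : r <> c :> X by move=> rc; apply: (@affineP _ r); rewrite rc.
have Lq : hull [:: c; (p : X)] q by rewrite /c; have := @dir_hullR _ p q; hull_tac.
have [s [sd sL sp]] := @central_collineation G c p q Lq (neqc _) (neqc _).
exists s; split=> // x.
have fixed y z : s y = y -> ~ hull [:: c; (y : X)] z -> s z = z.
  move=> sy nz; apply: contrapT => szz; apply: nz.
  have yz : dir y (s z) = dir y z by rewrite -{1}sy sd.
  have [Lc _] := hull2_eq (@affine_proper _ z) (affine_hull1 (nesym szz))
    (ltac:(hull_tac) : hull [:: c; (z : X)] z) (sL z).
  have [Ly _] := hull2_eq (@affine_proper _ z) (affine_hull1 (nesym szz))
    (ltac:(hull_tac) : hull [:: (y : X); (z : X)] z) (dir_eq_hullR (esym yz)).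
  have [//] := hull2_eq c0 (hull1_proper (@affine_proper _ y) (neqc y)) Lc Ly.
have moved y : s y <> y.
  move=> sy; have [z nz] := affine_off_plane y c c.
  have {}nz : ~ hull [:: c; (y : X)] z by move=> H; apply: nz; hull_tac.
  have sz := fixed _ _ sy nz.
  suff : s p = p by rewrite sp; exact: nesym.
  have [yp|/(fixed _ _ sy)//] := pselect (hull [:: c; (y : X)] p).
  have [zp|/(fixed _ _ sz)//] := pselect (hull [:: c; (z : X)] p).
  by case: (ray_disjoint nz (neqc p) yp zp).
apply: dir_uniqueR => //; first exact: nesym.
by have := sL x; hull_tac.
Qed.

End Dilatations.

(** * The translation group *)

Section Translations.
Variable G : geometry.
Local Notation X := (carrier G).
Local Notation o := (origin G).
Local Notation O := (aorigin G).
Implicit Types (p q r x y z u v w : affine G) (s t : affine G -> affine G).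

Lemma off_line p (e : X) : exists q, ~ hull [:: (p : X); e] q.
Proof.
have [q nq] := affine_off_plane p e e; exists q => H; apply: nq; hull_tac.
Qed.

Lemma dir_on_line x y z w : z <> w -> hull [:: (x : X); (y : X)] z ->
  hull [:: (x : X); (y : X)] w -> dir z w = dir x y.
Proof.
move=> zw Lz Lw; have nzw := affine_hull1 zw.
have [Lx Ly] := hull2_eq (@affine_proper _ z) nzw Lz Lw.
apply: dir_unique; [|exact: dir_orth|].
  by have := @dir_hull _ x y; hull_tac.
move=> /dir_eq0 xy; apply: zw; apply: affine_inj; rewrite xy in Lz Lw.
have {}Lz : hull [:: (y : X)] z by hull_tac.
have {}Lw : hull [:: (y : X)] w by hull_tac.
have [/affine_proper//|->] := hull1 Lz.
by have [/affine_proper//|->] := hull1 Lw.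
Qed.

Definition dilatation s := forall x y, dir (s x) (s y) = dir x y.

(** Off the line [p q], an image is determined by its directions from the images of [p] and [q]; on
    that line, an auxiliary [r] replaces [q]. *)
Lemma dilatation_unique s t p q : dilatation s -> dilatation t -> p <> q ->
  s p = t p -> s q = t q -> s =1 t.
Proof.
have off u v w : dilatation s -> dilatation t -> u <> v -> s u = t u -> s v = t v ->
    ~ hull [:: (u : X); (v : X)] w -> s w = t w.
  move=> ds dt uv su sv nw; apply: (@affine_unique _ (s u) (s v)).
  - by rewrite ds su dt.
  - by rewrite ds sv dt.
  rewrite !ds => E; apply: nw; have := @dir_hullR _ v w; rewrite -E dirC.
  move=> H; have L1 := @dir_hull _ w u.
  have L2 : dir w u = dir w v by rewrite dirC E dirC.
  have := dir_eq_hullR L2 => L3.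
  have L4 : hull [:: (w : X); (u : X)] v by [].
  have L5 := exchange L4 (affine_hull1 uv).
  by hull_tac.
move=> ds dt pq sp sq x.
have [Lx|nx] := pselect (hull [:: (p : X); (q : X)] x); last exact: (off p q).
have [->//|xp] := pselect (x = p).
have [r nr] := off_line p q.
have sr : s r = t r by apply: (off p q).
apply: (off p r) => // [pr|Lx']; first by apply: nr; rewrite -pr; hull_tac.
apply: nr; have H : hull [:: (r : X); (p : X)] x by hull_tac.
by have := exchange H (affine_hull1 (nesym xp)); hull_tac.
Qed.

(** The direction [ozero] is allowed, so the identity is a translation. *)
Definition translation s := dilatation s /\ exists c, forall x, dir x (s x) = c.

Lemma translation_dir s x y : translation s -> dir x (s x) = dir y (s y).
Proof. by move=> [_ [c cP]]; rewrite !cP. Qed.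

Lemma translation_unique s t p : translation s -> translation t -> s p = t p -> s =1 t.
Proof.
move=> hs ht sp.
have st x : dir x (s x) = dir x (t x).
  by rewrite (translation_dir x p hs) (translation_dir x p ht) sp.
have [E|E] := pselect (dir p (s p) = ozero).
  move=> x; have := st x; rewrite (translation_dir x p hs) E => /esym/dir_eq0 <-.
  by have := translation_dir x p hs; rewrite E => /dir_eq0 <-.
have [q nq] := off_line p (dir p (s p)).
have pq : p <> q by move=> pq; apply: nq; rewrite -pq; hull_tac.
have [ds _] := hs; have [dt _] := ht.
apply: (dilatation_unique ds dt pq sp).
apply: (@affine_unique _ q (s p)); first exact: st.
  by rewrite ds sp dt.
rewrite (translation_dir q p hs) ds => E'; apply: nq; rewrite E'; exact: dir_hullR.
Qed.

(* If two directions [dir x (s x)] differ, the corresponding lines, which [s]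
   preserves, meet in a fixed affine point. *)
Lemma dilatation_translation s : dilatation s -> (forall x, s x <> x) -> translation s.
Proof.
move=> ds nf; split=> //; exists (dir O (s O)) => x; move: (O) => y.
apply: contrapT => ne.
have yx : y <> x by move=> yx; apply: ne; rewrite yx.
have L1 : hull [:: (y : X); (s x : X); (x : X)] (s y).
  have := @dir_hullR _ (s x) (s y); rewrite ds; have := @dir_hull _ x y; hull_tac.
have [z Lz Lsy] := modular L1.
have z0 : z <> ozero.
  move=> z0; rewrite z0 in Lsy; have {}Lsy : hull [:: (y : X)] (s y) by hull_tac.
  by have [/affine_proper|/affine_inj/nf] := hull1 Lsy.
have Lxz : hull [:: (x : X); (s x : X)] z by hull_tac.
have zo : ~ z _|_ o.
  move=> zo; have E : dir x (s x) = z by exact: dir_unique.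
  apply: ne; rewrite E; apply/esym/dir_uniqueR => //; exact: nesym.
pose a : affine G := exist _ z zo; rewrite -[z]/(affine_point a) in Lxz Lsy.
have Lya : hull [:: (y : X); (s y : X)] a.
  have H : hull [:: (a : X); (y : X)] (s y) by hull_tac.
  by have := exchange H (affine_hull1 (nesym (nf y))); hull_tac.
have on w : hull [:: (w : X); (s w : X)] a -> hull [:: (w : X); (s w : X)] (s a).
  move=> Lw; have [->|wa] := pselect (a = w); first by hull_tac.
  have E : dir (s w) (s a) = dir w (s w) by rewrite ds; apply: dir_eq_hull => //; exact: nesym.
  by have := @dir_hullR _ (s w) (s a); rewrite E; have := @dir_hull _ w (s w); hull_tac.
apply: ne; rewrite -(@dir_on_line x (s x) a (s a)) //; [|exact/nesym|exact: on].
by rewrite -(@dir_on_line y (s y) a (s a)) //; [exact/nesym|exact: on].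
Qed.

Lemma dilatation_comp s t : dilatation s -> dilatation t -> dilatation (s \o t).
Proof. by move=> ds dt x y /=; rewrite ds dt. Qed.

(** Without a fixed point, [dilatation_translation] applies. With a fixed point [x], a second one is
    found off the line [x (t x)], or [t] is the identity; either way the composite is the
    identity. *)
Lemma translation_comp s t : translation s -> translation t -> translation (s \o t).
Proof.
move=> hs ht; have [ds _] := hs; have [dt _] := ht.
have dst := dilatation_comp ds dt.
have [[x stx]|nf] := pselect (exists x, s (t x) = x); last first.
  by apply: dilatation_translation => // x stx; apply: nf; exists x.
split=> //; exists ozero => y; apply/dir_eq0 => /=; move: y.
have sc y : dir (t y) (s (t y)) = dir x (t x).
  by rewrite (translation_dir (t y) (t x) hs) stx dirC.
have [E|E] := pselect (dir x (t x) = ozero).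
  move=> y; have := translation_dir y x ht; rewrite E => /dir_eq0 ty.
  by have := sc y; rewrite E -ty => /dir_eq0.
have [y ny] := off_line x (dir x (t x)).
have xy : x <> y by move=> xy; apply: ny; rewrite -xy; hull_tac.
suff sty : s (t y) = y.
  have H := @dilatation_unique (s \o t) id x y dst (fun _ _ => erefl) xy stx sty.
  by move=> z; have /= -> := H z.
apply: (@affine_unique _ (t y) x).
- by rewrite sc (dirC (t y)) (translation_dir y x ht).
- by rewrite -{1}stx ds dt.
rewrite sc -[in dir x (s _)]stx ds dt => E'; apply: ny; rewrite E'; exact: dir_hullR.
Qed.

Lemma translation_ex p q : exists s, translation s /\ s p = q.
Proof.
have [<-|pq] := pselect (p = q).
  by exists id; do !split=> //; exists ozero => x; exact: dirxx.
have [s [sd sc sp]] := translation_exists pq.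
by exists s; split=> //; split=> //; exists (dir p q).
Qed.

(** The translation moving [O] to [u]; read as a binary operation, this is the addition of the
    affine part. *)
Definition tau u : affine G -> affine G := projT1 (cid (translation_ex O u)).

Lemma tau_translation u : translation (tau u).
Proof. by rewrite /tau; case: cid => s []. Qed.

Lemma tauO u : tau u O = u.
Proof. by rewrite /tau; case: cid => s []. Qed.

Global Opaque tau.

Lemma tau_dil u x y : dir (tau u x) (tau u y) = dir x y.
Proof. by have [] := tau_translation u. Qed.

Lemma tau_dir u x : dir x (tau u x) = dir O u.
Proof. by rewrite (translation_dir x O (tau_translation u)) tauO. Qed.

Lemma tau_tau u v w : tau (tau u v) w = tau u (tau v w).
Proof.
apply: (translation_unique (s := tau (tau u v)) (t := tau u \o tau v) (p := O)).
- exact: tau_translation.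
- by apply: translation_comp; exact: tau_translation.
- by rewrite /= !tauO.
Qed.

Lemma tau0 w : tau O w = w.
Proof. by have := tau_dir O w; rewrite dirxx => /dir_eq0. Qed.

Lemma tauN u : exists v, tau v u = O.
Proof.
have [s [st su]] := translation_ex u O; exists (s O).
by rewrite (translation_unique (tau_translation (s O)) st (tauO (s O))).
Qed.

Lemma tau_dirl u v : dir u (tau u v) = dir O v.
Proof. by rewrite -{1}(tauO u) tau_dil. Qed.

(** For different directions both sides are the fourth vertex of a parallelogram. For equal ones,
    some [w] off the line is added and then cancelled. *)
Lemma tauC u v : tau u v = tau v u.
Proof.
have comm a b : dir O a <> dir O b -> tau a b = tau b a.
  move=> ab; apply: (@affine_unique _ a b).
  - by rewrite tau_dirl tau_dir.
  - by rewrite tau_dirl tau_dir.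
  by rewrite tau_dirl tau_dir; exact: nesym.
have [uv|/comm//] := pselect (dir O u = dir O v).
have [->|uO] := pselect (u = O); first by rewrite tau0 tauO.
have [w nw] := off_line O (dir O u).
have duw : dir O u <> dir O w by move=> E; apply: nw; rewrite E; exact: dir_hullR.
have Lv : hull [:: (O : X); (u : X)] v by exact: dir_eq_hullR.
have Ewv := tau_dirl v w.
have duvw : dir O u <> dir O (tau v w).
  move=> E; apply: duw; rewrite -Ewv; apply/esym/dir_on_line => //.
    by move=> E'; have := Ewv; rewrite -E' dirxx => /esym/dir_eq0 Ow; apply: nw; rewrite -Ow; hull_tac.
  exact: dir_eq_hullR.
have E : tau (tau u v) w = tau (tau v u) w.
  by rewrite !tau_tau (comm _ _ duvw) tau_tau (comm u w).
have := translation_unique (tau_translation _) (tau_translation _) E O.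
by rewrite !tauO.
Qed.

End Translations.

(** * The affine part as an abelian group *)

HB.instance Definition _ (G : geometry) := gen_eqMixin (affine G).
HB.instance Definition _ (G : geometry) := gen_choiceMixin (affine G).

Section Group.
Variable G : geometry.
Local Notation X := (carrier G).
Local Notation o := (origin G).
Implicit Types (p q r x y z u v w : affine G) (s t : affine G -> affine G).

Lemma tauA : associative (@tau G).
Proof. by move=> u v w; rewrite tau_tau. Qed.

Definition aopp u : affine G := projT1 (cid (tauN u)).

Lemma tauNl : left_inverse (aorigin G) aopp (@tau G).
Proof. by move=> u; rewrite /aopp; case: cid. Qed.

End Group.

HB.instance Definition _ (G : geometry) :=
  GRing.isZmodule.Build (affine G) (@tauA G) (@tauC G) (@tau0 G) (@tauNl G).

Section Group.
Variable G : geometry.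
Local Notation X := (carrier G).
Local Notation o := (origin G).
Implicit Types (p q r x y z u v w : affine G) (s t : affine G -> affine G).

Lemma affine0E : (0 : affine G) = o :> X. Proof. by []. Qed.

Definition slope u : X := dir 0 u.

Lemma slope_dir u v : dir u v = slope (v - u).
Proof. by rewrite /slope -(tau_dil (- u) u v) [tau _ u]addNr [tau _ v]addrC. Qed.

Lemma slope_addl u v : dir u (u + v) = slope v.
Proof. by rewrite slope_dir (addrC u) addrK. Qed.

Lemma slope_addr u v : dir u (v + u) = slope v.
Proof. by rewrite addrC slope_addl. Qed.

Lemma slope0 : slope 0 = ozero. Proof. exact: dirxx. Qed.

Lemma slope_eq0 u : slope u = ozero <-> u = 0.
Proof. by split=> [/dir_eq0 <-//|->]; exact: slope0. Qed.

Lemma slope_orth u : slope u _|_ o. Proof. exact: dir_orth. Qed.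

Lemma slopeN u : slope (- u) = slope u.
Proof. by rewrite -[- u]add0r -slope_dir dirC. Qed.

Lemma slopeB u v : slope u = slope v -> u <> v -> slope (u - v) = slope u.
Proof.
move=> uv nuv; rewrite -slope_dir; apply: (@dir_on_line _ 0 u v u).
- exact: nesym.
- exact: dir_eq_hullR.
- hull_tac.
Qed.

Lemma slope_hullD u v : hull [:: slope u; slope v] (slope (u + v)).
Proof.
apply: (@hyper_hull _ (0 : affine G)); [by split; [|split=> //]; exact: slope_orth|exact: slope_orth|].
have L1 := @dir_hullR _ u (u + v); rewrite slope_addl in L1.
have L2 : hull [:: (0 : affine G) : X; slope u] u := @dir_hullR _ 0 u.
have L3 : hull [:: (0 : affine G) : X; (u + v : affine G) : X] (slope (u + v)) := @dir_hull _ 0 (u + v).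
hull_tac.
Qed.

Lemma slope_off u : exists v, v <> 0 /\ slope u <> slope v.
Proof.
have [v nv] := off_line (0 : affine G) (slope u); exists v; split.
  by move=> v0; apply: nv; rewrite v0; hull_tac.
by move=> E; apply: nv; rewrite E; exact: dir_hullR.
Qed.

(** As functions of [v], both sides are dilatations; they agree at 0 and, completing a
    parallelogram, at a [v] of another slope. *)
Lemma homothety_additive s : dilatation s -> s 0 = 0 -> {morph s : u v / u + v}.
Proof.
move=> ds s0 u; have sl w : slope (s w) = slope w by rewrite /slope -{1}s0 ds.
have [->|u0] := pselect (u = 0); first by move=> v; rewrite s0 !add0r.
have [v [v0 uv]] := slope_off u.
apply: (@dilatation_unique G (fun v => s (u + v)) (fun v => s u + s v) 0 v).
- by move=> x y; rewrite ds; exact: tau_dil.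
- by move=> x y; rewrite -(ds x y); exact: tau_dil.
- exact: nesym.
- by rewrite s0 !addr0.
apply: (@affine_unique _ (s v) (s u)).
- by rewrite ds !slope_addr sl.
- by rewrite ds !slope_addl sl.
by rewrite !ds slope_addr slope_addl.
Qed.

Lemma homothety_ex u v : u <> 0 -> v <> 0 -> slope u = slope v ->
  exists s, [/\ {morph s : x y / x + y}, forall x, slope (s x) = slope x & s u = v].
Proof.
move=> u0 v0 uv; have [s [sd s0 su]] := homothety_exists u0 v0 uv.
exists s; split=> //; first exact: homothety_additive.
by move=> x; rewrite /slope -{1}[0]s0 sd.
Qed.

End Group.

(** * The sfield of slope-preserving endomorphisms *)

Definition slope_preserving (G : geometry) (f : affine G -> affine G) : Prop :=
  {morph f : x y / x + y} /\ forall x, f x = 0 \/ slope (f x) = slope x.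

Definition multiplier (G : geometry) : Type := {f | @slope_preserving G f}.

HB.instance Definition _ (G : geometry) := gen_eqMixin (multiplier G).
HB.instance Definition _ (G : geometry) := gen_choiceMixin (multiplier G).

Section Scalars.
Variable G : geometry.
Local Notation V := (affine G).
Local Notation F := (multiplier G).
Implicit Types (f g h : F) (u v w x y : V).

Lemma multiplier_ext f g : (forall x, sval f x = sval g x) -> f = g.
Proof. by case: f g => [f fP] [g gP] /= fg; apply: eq_exist; exact: funext. Qed.

Lemma multiplierD f x y : sval f (x + y) = sval f x + sval f y.
Proof. by have [] := svalP f. Qed.

Lemma multiplier_slope f x : sval f x = 0 \/ slope (sval f x) = slope x.
Proof. by have [] := svalP f. Qed.

Lemma multiplier0x f : sval f 0 = 0.
Proof. by apply: (addrI (sval f 0)); rewrite -multiplierD !addr0. Qed.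

Lemma zero_slope_preserving : slope_preserving (fun _ : V => 0).
Proof. by split=> [x y|x]; [rewrite addr0|left]. Qed.

Lemma one_slope_preserving : slope_preserving (@id V).
Proof. by split=> // x; right. Qed.

Lemma add_slope_preserving f g : slope_preserving (fun x => sval f x + sval g x).
Proof.
split=> [x y|x]; first by rewrite !multiplierD addrACA.
have [->|fx] := multiplier_slope f x; first by rewrite add0r; exact: multiplier_slope.
have [->|gx] := multiplier_slope g x; first by rewrite addr0; right.
have [fg|fg] := pselect (sval f x = - sval g x); first by left; rewrite fg addNr.
by right; rewrite -[sval g x]opprK slopeB // slopeN gx fx.
Qed.

Lemma opp_slope_preserving f : slope_preserving (fun x => - sval f x).
Proof.
split=> [x y|x]; first by rewrite multiplierD opprD.
have [->|fx] := multiplier_slope f x; first by left; rewrite oppr0.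
by right; rewrite slopeN.
Qed.

Lemma mul_slope_preserving f g : slope_preserving (fun x => sval f (sval g x)).
Proof.
split=> [x y|x]; first by rewrite !multiplierD.
have [->|gx] := multiplier_slope g x; first by left; rewrite multiplier0x.
by have [->|fx] := multiplier_slope f (sval g x); [left|right; rewrite fx].
Qed.

Definition multiplier0 : F := exist _ _ zero_slope_preserving.
Definition multiplier1 : F := exist _ _ one_slope_preserving.
Definition multiplier_add f g : F := exist _ _ (add_slope_preserving f g).
Definition multiplier_opp f : F := exist _ _ (opp_slope_preserving f).
Definition multiplier_mul f g : F := exist _ _ (mul_slope_preserving f g).

Lemma multiplier_addA : associative multiplier_add.
Proof. by move=> f g h; apply: multiplier_ext => x /=; rewrite addrA. Qed.
Lemma multiplier_addC : commutative multiplier_add.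
Proof. by move=> f g; apply: multiplier_ext => x /=; rewrite addrC. Qed.
Lemma multiplier_add0 : left_id multiplier0 multiplier_add.
Proof. by move=> f; apply: multiplier_ext => x /=; rewrite add0r. Qed.
Lemma multiplier_addN : left_inverse multiplier0 multiplier_opp multiplier_add.
Proof. by move=> f; apply: multiplier_ext => x /=; rewrite addNr. Qed.
Lemma multiplier_mulA : associative multiplier_mul.
Proof. by move=> f g h; apply: multiplier_ext. Qed.
Lemma multiplier_mul1l : left_id multiplier1 multiplier_mul.
Proof. by move=> f; apply: multiplier_ext. Qed.
Lemma multiplier_mul1r : right_id multiplier1 multiplier_mul.
Proof. by move=> f; apply: multiplier_ext. Qed.
Lemma multiplier_mulDl : left_distributive multiplier_mul multiplier_add.
Proof. by move=> f g h; apply: multiplier_ext. Qed.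
Lemma multiplier_mulDr : right_distributive multiplier_mul multiplier_add.
Proof. by move=> f g h; apply: multiplier_ext => x /=; rewrite multiplierD. Qed.

Lemma exists_nonzero : exists e : V, e <> 0.
Proof. by have [v [v0 _]] := slope_off (0 : V); exists v. Qed.

Lemma multiplier1_neq0 : multiplier1 != multiplier0.
Proof.
by have [e e0] := exists_nonzero; apply/eqP => /(congr1 (fun f => sval f e)) /= /e0.
Qed.

End Scalars.

HB.instance Definition _ (G : geometry) := GRing.isZmodule.Build (multiplier G)
  (@multiplier_addA G) (@multiplier_addC G) (@multiplier_add0 G) (@multiplier_addN G).
HB.instance Definition _ (G : geometry) := GRing.Zmodule_isNzRing.Build (multiplier G)
  (@multiplier_mulA G) (@multiplier_mul1l G) (@multiplier_mul1r G) (@multiplier_mulDl G)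
  (@multiplier_mulDr G) (@multiplier1_neq0 G).

Section ScalarInverse.
Variable G : geometry.
Local Notation V := (affine G).
Local Notation F := (multiplier G).
Implicit Types (f g h : F) (u v w x y : V).

(* If [f x = 0], then [f y = f (x + y)] lies on the lines of both [y] and [x + y]. *)
Lemma multiplier_eq0 f u : u <> 0 -> sval f u = 0 -> f = 0.
Proof.
have off x y : x <> 0 -> sval f x = 0 -> slope x <> slope y -> sval f y = 0.
  move=> x0 fx xy; have fD : sval f (x + y) = sval f y by rewrite multiplierD fx add0r.
  have [//|fy] := multiplier_slope f y; have [fy0|fxy] := multiplier_slope f (x + y).
    by rewrite -fD.
  have E : slope (x + y) = slope y by rewrite -fxy fD.
  case: xy; rewrite -[x in slope x](addrK y) slopeB //.
  by move=> xyy; apply: x0; apply: (addIr y); rewrite add0r.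
move=> u0 fu; apply: multiplier_ext => v /=.
have [w [w0 uw]] := slope_off u; have fw := off _ _ u0 fu uw.
have [uv|uv] := pselect (slope u = slope v); last exact: (off u).
by apply: (off w) => //; rewrite -uv; exact: nesym.
Qed.

Lemma multiplier_transitive u v : u <> 0 -> v <> 0 -> slope u = slope v ->
  exists f, sval f u = v.
Proof.
move=> u0 v0 /(homothety_ex u0 v0) [s [sD sS su]].
by exists (exist _ s (conj sD (fun x => or_intror (sS x)))).
Qed.

(** Some [g] takes [f e] back to [e]; then [g * f - 1] kills [e] and hence vanishes. *)
Lemma multiplier_left_inverse f : f <> 0 -> exists g, g * f = 1.
Proof.
move=> f0; have [e e0] := exists_nonzero G.
have fe0 : sval f e <> 0 by move/(multiplier_eq0 e0).
have [//|/(multiplier_transitive fe0 e0) [g ge]] := multiplier_slope f e.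
exists g; apply/eqP; rewrite -subr_eq0; apply/eqP; apply: (multiplier_eq0 e0).
by rewrite /= ge subrr.
Qed.

Lemma multiplier_inverse f : exists g, f <> 0 -> g * f = 1 /\ f * g = 1.
Proof.
have [->|f0] := pselect (f = 0); first by exists 0.
have [g gf] := multiplier_left_inverse f0; exists g => _; split=> //.
have g0 : g <> 0.
  by move=> g0; move: gf; rewrite g0 mul0r => /esym/eqP; rewrite oner_eq0.
have [h hg] := multiplier_left_inverse g0.
by have <- : h = f by rewrite -[h]mulr1 -gf mulrA hg mul1r.
Qed.

Definition multiplier_unit : pred F := fun f => f != 0.

Definition multiplier_inv f : F := if f == 0 then f else projT1 (cid (multiplier_inverse f)).

Lemma multiplier_mulVr : {in multiplier_unit, left_inverse 1 multiplier_inv *%R}.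
Proof.
move=> f; rewrite unfold_in /multiplier_inv => /negPf f0; rewrite f0.
by case: cid => g /= [] //; apply/eqP; rewrite f0.
Qed.

Lemma multiplier_mulrV : {in multiplier_unit, right_inverse 1 multiplier_inv *%R}.
Proof.
move=> f; rewrite unfold_in /multiplier_inv => /negPf f0; rewrite f0.
by case: cid => g /= [] //; apply/eqP; rewrite f0.
Qed.

Lemma multiplier_unitP f g : g * f = 1 /\ f * g = 1 -> multiplier_unit f.
Proof.
move=> [gf _]; apply/eqP => f0; move: gf; rewrite f0 mulr0 => /esym/eqP.
by rewrite oner_eq0.
Qed.

Lemma multiplier_inv_out : {in [predC multiplier_unit], multiplier_inv =1 id}.
Proof.
by move=> f; rewrite !inE [_ \in _]unfold_in /multiplier_unit negbK /multiplier_inv => ->.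
Qed.

End ScalarInverse.

HB.instance Definition _ (G : geometry) := GRing.NzRing_hasMulInverse.Build (multiplier G)
  (@multiplier_mulVr G) (@multiplier_mulrV G) (@multiplier_unitP G) (@multiplier_inv_out G).

Lemma multiplier_unitE (G : geometry) (f : multiplier G) : f != 0 -> f \is a GRing.unit.
Proof. by []. Qed.

Section Module.
Variable G : geometry.
Implicit Types (f g h : multiplier G) (u v w x y : affine G).

Definition multiplier_scale f u : affine G := sval f u.

Lemma multiplier_scaleA f g u : multiplier_scale f (multiplier_scale g u) = multiplier_scale (f * g) u.
Proof. by []. Qed.
Lemma multiplier_scale1 : left_id 1 multiplier_scale.
Proof. by []. Qed.
Lemma multiplier_scaleDr : right_distributive multiplier_scale +%R.
Proof. by move=> f u v; exact: multiplierD. Qed.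
Lemma multiplier_scaleDl u : {morph multiplier_scale^~ u : f g / f + g}.
Proof. by []. Qed.

End Module.

HB.instance Definition _ (G : geometry) :=
  GRing.Zmodule_isLmodule.Build (multiplier G) (affine G) (@multiplier_scaleA G)
    (@multiplier_scale1 G) (@multiplier_scaleDr G) (@multiplier_scaleDl G).

Section ModuleTheory.
Variable G : geometry.
Implicit Types (a b : multiplier G) (u v w x y : affine G).

Lemma scaler_slope a u : a *: u = 0 \/ slope (a *: u) = slope u.
Proof. exact: multiplier_slope. Qed.

Lemma scaler_eq0P a u : a *: u = 0 -> a = 0 \/ u = 0.
Proof.
move=> au; have [->|u0] := pselect (u = 0); first by right.
by left; apply: (multiplier_eq0 u0).
Qed.

Lemma slopeZ a u : a <> 0 -> slope (a *: u) = slope u.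
Proof.
move=> a0; have [/scaler_eq0P[//|->]|//] := scaler_slope a u.
by rewrite scaler0.
Qed.

Lemma slope_eqP u v : u <> 0 -> v <> 0 -> slope u = slope v ->
  exists2 a, a <> 0 & v = a *: u.
Proof.
move=> u0 v0 uv; have [a au] := multiplier_transitive u0 v0 uv; exists a => //.
by move=> a0; apply: v0; rewrite -au a0.
Qed.

End ModuleTheory.

(** * The Hermitian form *)

Section Form.
Variable G : geometry.
Local Notation X := (carrier G).
Local Notation o := (origin G).
Local Notation V := (affine G).
Local Notation F := (multiplier G).
Implicit Types (a b c : F) (u v w x y z : V).

Lemma slope_hull u : hull [:: (0 : V) : X; slope u] u.
Proof. exact: dir_hullR. Qed.

Lemma hull_slope u : hull [:: (0 : V) : X; (u : X)] (slope u).
Proof. exact: dir_hull. Qed.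

Lemma slope_perp u v : slope u _|_ v <-> slope u _|_ slope v.
Proof.
have uo : (0 : V) _|_ slope u by apply/operp_sym; exact: slope_orth.
by split=> /operp_sym H; apply/operp_sym; [apply: hull_slope|apply: slope_hull].
Qed.

Lemma slope_perpC u v : slope u _|_ v <-> slope v _|_ u.
Proof. by rewrite slope_perp perpC -slope_perp. Qed.

Lemma slope_perpD x y v : slope x _|_ v -> slope y _|_ v -> slope (x + y) _|_ v.
Proof. by move=> xv yv; apply: slope_hullD. Qed.

Lemma slope_perpZ a x v : slope x _|_ v -> slope (a *: x) _|_ v.
Proof.
by have [->|->] := scaler_slope a x => // _; rewrite slope0; exact: perp0x.
Qed.

Lemma affine_perp x y v : x _|_ v -> (y _|_ v <-> slope (y - x) _|_ v).
Proof.
move=> xv; rewrite -slope_dir; split=> yv; first exact: (@dir_hull _ x y).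
exact: (@dir_hullR _ x y).
Qed.

(** Otherwise [o], which lies on the line of [x] and [slope x], would be orthogonal to [v]. *)
Lemma slope_not_perp x v : x _|_ v -> ~ slope x _|_ v.
Proof.
move=> xv sv; apply: (@affineP _ v); apply/operp_sym.
have := @dir_hullR _ x 0; rewrite dirC => H; exact: H.
Qed.

(* The points orthogonal to [v] are the translates by [x0] of the vectors whose slope
   is orthogonal to [v]. *)
Lemma functional_ex v : exists f : V -> F,
  [/\ {morph f : x y / x + y}, forall a x, f (a *: x) = a * f x,
      forall x, x _|_ v <-> f x = -1 & forall x, f x = 0 <-> slope x _|_ v].
Proof.
(* No affine point is orthogonal to [o], and the zero functional never takes the value -1. *)
have [->|v0] := pselect (v = 0).
  exists (fun=> 0); split=> [x y|a x|x|x]; rewrite ?addr0 ?mulr0 //.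
    split=> [/affineP//|/eqP]; rewrite eq_sym oppr_eq0 oner_eq0 //.
  by split=> // _; exact: slope_orth.
(* If no affine point were orthogonal to [v], everything orthogonal to [v] would be orthogonal to
   [o], making [v] equal to [o]. *)
have [x0 x0v] : exists x0, x0 _|_ v.
  apply: contrapT => nx0; apply: v0; apply: affine_inj; rewrite affine0E.
  suff H : hull [:: (v : X)] o by have [/(@origin_proper G)|] := hull1 H.
  move=> b [vb _]; apply: contrapT => ob; apply: nx0.
  have nbo : ~ b _|_ o by move/operp_sym.
  by exists (exist _ b nbo); exact/operp_sym.
(* The line from 0 through [x] meets the orthocomplement of [v] in an affine point [b *: x], unless
   [slope x _|_ v]. Then [b *: x - x0] has slope orthogonal to [v], so the coefficient is
   [- b^-1]. *)
have ex x : exists a, slope (x + a *: x0) _|_ v.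
  have [xv|xv] := pselect (slope x _|_ v); first by exists 0; rewrite scale0r addr0.
  have x_neq0 : (0 : V) <> x by move=> x_eq0; apply: xv; rewrite -x_eq0 slope0; exact: perp0x.
  have [b [b0 Lb bv]] := line_hyperplane v (@affine_proper _ (0 : V)) (affine_hull1 x_neq0).
  have bo : ~ b _|_ o.
    move=> bo; have E : dir 0 x = b by exact: dir_unique.
    by apply: xv; rewrite /slope E.
  pose w : V := exist _ b bo; rewrite -[b]/(affine_point w) in Lb bv.
  have w0 : w <> 0.
    by move=> w0; apply: (@affineP _ v); apply/operp_sym; move: bv; rewrite w0.
  have xw : slope x = slope w by apply/esym/dir_eq_hull => //; exact: nesym.
  have [a a0 wE] := slope_eqP (nesym x_neq0) w0 xw.
  exists (- a^-1); have /(affine_perp w) := x0v => -[/(_ bv) H _].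
  move/(slope_perpZ a^-1): H.
  by rewrite wE scalerBr scalerA mulVr ?scale1r ?scaleNr //; apply/multiplier_unitE/eqP.
have uniq x a b : slope (x + a *: x0) _|_ v -> slope (x + b *: x0) _|_ v -> a = b.
  move=> xa xb; apply: contrapT => ab; apply: (slope_not_perp x0v).
  rewrite -(@slopeZ _ (a - b)); last by move/eqP; rewrite subr_eq0 => /eqP.
  have -> : (a - b) *: x0 = (x + a *: x0) + (-1) *: (x + b *: x0).
    by rewrite scaleN1r opprD addrACA subrr add0r scalerBl.
  by apply: slope_perpD => //; exact: slope_perpZ.
pose f x := projT1 (cid (ex x)).
have fP x : slope (x + f x *: x0) _|_ v by rewrite /f; case: cid.
exists f; split=> [x y|a x|x|x].
- apply: (uniq (x + y)) => //; rewrite scalerDl addrACA.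
  exact: slope_perpD.
- by apply: (uniq (a *: x)) => //; rewrite -scalerA -scalerDr; exact: slope_perpZ.
- rewrite (affine_perp x x0v); split=> [xx0|fx].
    by apply: (uniq x) => //; rewrite scaleN1r.
  by have := fP x; rewrite fx scaleN1r.
- split=> [fx|xv]; first by have := fP x; rewrite fx scale0r addr0.
  by apply: (uniq x) => //; rewrite scale0r addr0.
Qed.

(* Normalised such that [x _|_ v] if and only if [form x v = -1], that is, [(1, x)]
   and [(1, v)] are orthogonal. *)
Definition form x v : F := projT1 (cid (functional_ex v)) x.

Lemma formDl v x y : form (x + y) v = form x v + form y v.
Proof. by rewrite /form; case: cid => f []. Qed.

Lemma formZl v a x : form (a *: x) v = a * form x v.
Proof. by rewrite /form; case: cid => f []. Qed.

Lemma form_perp x v : x _|_ v <-> form x v = -1.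
Proof. by rewrite /form; case: cid => f []. Qed.

Lemma form_eq0 x v : form x v = 0 <-> slope x _|_ v.
Proof. by rewrite /form; case: cid => f []. Qed.

Global Opaque form.

Lemma formx0 x : form x 0 = 0.
Proof. by apply/form_eq0; exact: slope_orth. Qed.

Lemma form0C x v : form x v = 0 <-> form v x = 0.
Proof. by rewrite !form_eq0 slope_perpC. Qed.

(** Otherwise all that is orthogonal to [v] and [slope v'] is orthogonal to [o]. Then [o] lies on
    their line, and the slopes agree. *)
Lemma form_dual v v' : v <> 0 -> slope v <> slope v' ->
  exists x, form x v = -1 /\ form x v' = 0.
Proof.
move=> v0 vv'; apply: contrapT => nx; apply: vv'.
suff H : hull [:: (v : X); slope v'] (0 : V).
  by rewrite /slope dirC; apply: dir_uniqueR => //; exact: slope_orth.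
move=> b [vb [vb' _]]; apply: contrapT => ob; apply: nx.
have nbo : ~ b _|_ o by move/operp_sym.
exists (exist _ b nbo); split; first by apply/form_perp; exact/operp_sym.
by apply/form0C/form_eq0.
Qed.

(* A point orthogonal to [v] and [w] is orthogonal to [v + w], so the functional of
   [v + w] is a combination of those of [v] and [w]; the coefficients are found at
   the dual points [y], [z]. *)
Lemma formDr_off x v w : v <> 0 -> w <> 0 -> slope v <> slope w ->
  form x (v + w) = form x v + form x w.
Proof.
move=> v0 w0 vw.
have [y [yv yw]] := form_dual v0 vw; have [z [zw zv]] := form_dual w0 (nesym vw).
have L1 := @dir_hullR _ v (v + w); rewrite slope_addl in L1.
have L2 := @dir_hullR _ w (v + w); rewrite slope_addr in L2.
have orth_sum u v' w' : hull [:: (v' : X); slope w'] (v + w : V) ->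
    form u v' = -1 -> form u w' = 0 -> form u (v + w) = -1.
  move=> L /form_perp uv /form0C/form_eq0 uw; apply/form_perp/operp_sym/L.
  by split; [exact/operp_sym|].
have orth0 u : form u v = 0 -> form u w = 0 -> form u (v + w) = 0.
  move=> /form_eq0 uv /form_eq0 uw; apply/form_eq0/operp_sym/L1.
  by split; [|split=> //]; apply/operp_sym => //; exact/slope_perp.
have yvw := orth_sum _ _ _ L1 yv yw; have zvw := orth_sum _ _ _ L2 zw zv.
pose u := x + form x v *: y + form x w *: z.
have : form u (v + w) = 0.
  by apply: orth0; rewrite !formDl !formZl ?yv ?yw ?zv ?zw !mulrN !mulr1 !mulr0 ?addr0 subrr.
rewrite !formDl !formZl yvw zvw !mulrN !mulr1 => /eqP.
by rewrite -addrA -opprD subr_eq0 => /eqP.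
Qed.

Lemma formDr x v w : form x (v + w) = form x v + form x w.
Proof.
have [->|v0] := pselect (v = 0); first by rewrite formx0 !add0r.
have [->|w0] := pselect (w = 0); first by rewrite formx0 !addr0.
have [vw|] := pselect (slope v = slope w); last exact: formDr_off.
have [z [z0 vz]] := slope_off v.
have wz0 : w + z <> 0.
  by move=> wz0; apply: vz; rewrite vw -slopeN; congr slope; apply/eqP; rewrite eq_sym -addr_eq0 addrC; apply/eqP.
have vwz : slope v <> slope (w + z).
  move=> E; apply: vz; have zE : z = (w + z) - w by rewrite addrAC subrr add0r.
  rewrite [in RHS]zE slopeB //; first by rewrite -E.
  by move=> /eqP; rewrite -subr_eq0 addrAC subrr add0r => /eqP.
have wz : slope w <> slope z by rewrite -vw.
have E : form x (v + w + z) = form x v + form x w + form x z.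
  by rewrite -addrA (formDr_off x v0 wz0 vwz) (formDr_off x w0 z0 wz) addrA.
have [vw0|vw0] := pselect (v + w = 0).
  rewrite vw0 formx0; move: E; rewrite vw0 add0r => /eqP.
  by rewrite -subr_eq0 opprD addrCA subrr addr0 oppr_eq0 => /eqP ->.
apply: (addIr (form x z)); rewrite -E; apply/esym/formDr_off => //.
rewrite -[w]opprK slopeB // ?slopeN //.
by move=> E'; apply: vw0; rewrite E' addNr.
Qed.

Lemma formNr x v : form x (- v) = - form x v.
Proof. by apply/eqP; rewrite -addr_eq0 -formDr addNr formx0. Qed.

(** The functional of [a *: v] vanishes where that of [v] does, so it is a right multiple of it; the
    factor is read off at [y], where [form y v = -1]. *)
Lemma form_multiple v a : v <> 0 -> exists r, forall x, form x (a *: v) = form x v * r.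
Proof.
move=> v0; have [w [w0 vw]] := slope_off v.
have [y [yv _]] := form_dual v0 vw.
exists (- form y (a *: v)) => x.
have H : form (x + form x v *: y) v = 0 by rewrite formDl formZl yv mulrN1 subrr.
have : form (x + form x v *: y) (a *: v) = 0.
  apply/form0C; rewrite form_eq0; apply: slope_perpZ.
  by apply/form_eq0/form0C.
by rewrite formDl formZl mulrN => /eqP; rewrite addr_eq0 => /eqP.
Qed.

(** The factors of [v] and [w] are both compared with that of [v + w], at points dual to [v] and
    [w]. *)
Lemma form_multiple_off v w a r : v <> 0 -> w <> 0 -> slope v <> slope w ->
  (forall x, form x (a *: v) = form x v * r) ->
  forall x, form x (a *: w) = form x w * r.
Proof.
move=> v0 w0 vw vr.
have vw0 : v + w <> 0.
  by move=> /eqP; rewrite addr_eq0 => /eqP E; apply: vw; rewrite E slopeN.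
have [s ws] := form_multiple a w0; have [t vwt] := form_multiple a vw0.
have [y [yv yw]] := form_dual v0 vw; have [z [zw zv]] := form_dual w0 (nesym vw).
have E x : form x v * r + form x w * s = (form x v + form x w) * t.
  by rewrite -vr -ws -formDr -vwt -formDr scalerDr.
have := E y; rewrite yv yw mul0r !addr0 !mulN1r => /oppr_inj ->.
by have := E z; rewrite zv zw mul0r !add0r !mulN1r => /oppr_inj <-.
Qed.

Lemma star_ex a : exists r, forall x v, form x (a *: v) = form x v * r.
Proof.
have [e e0] := exists_nonzero G; have [r er] := form_multiple a e0.
exists r => x v; have [->|v0] := pselect (v = 0); first by rewrite scaler0 formx0 mul0r.
have [ev|ev] := pselect (slope e = slope v); last exact: (form_multiple_off e0 v0 ev er).
have [w [w0 ew]] := slope_off e; have wr := form_multiple_off e0 w0 ew er.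
by apply: (form_multiple_off w0 v0 _ wr); rewrite -ev; exact: nesym.
Qed.

(** The involution is not chosen: it is what a scalar becomes when taken out of the second
    argument. *)
Definition fstar a : F := projT1 (cid (star_ex a)).

Lemma formZr a x v : form x (a *: v) = form x v * fstar a.
Proof. by rewrite /fstar; case: cid. Qed.

Lemma form_surj a : exists x v, form x v = a.
Proof.
have [v v0] := exists_nonzero G; have [w [w0 vw]] := slope_off v.
have [x [xv _]] := form_dual v0 vw.
by exists (- a *: x), v; rewrite formZl xv mulrNN mulr1.
Qed.

Lemma fstarD a b : fstar (a + b) = fstar a + fstar b.
Proof.
have [x [v xv]] := form_surj 1.
by rewrite -[LHS]mul1r -xv -formZr scalerDl formDr !formZr xv !mul1r.
Qed.

Lemma fstarM a b : fstar (a * b) = fstar b * fstar a.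
Proof.
have [x [v xv]] := form_surj 1.
by rewrite -[LHS]mul1r -xv -formZr -scalerA !formZr xv mul1r.
Qed.

Lemma fstarN1 : fstar (-1) = -1.
Proof.
have [x [v xv]] := form_surj 1.
by have := formZr (-1) x v; rewrite scaleN1r formNr xv mul1r => <-.
Qed.

Lemma fstar1 : fstar 1 = 1.
Proof.
have [x [v xv]] := form_surj 1.
by have := formZr 1 x v; rewrite scale1r xv mul1r => <-.
Qed.

Lemma fstar0 : fstar 0 = 0.
Proof. by apply: (addrI (fstar 0)); rewrite -fstarD !addr0. Qed.

Lemma form_sym u v : form u v = fstar (form v u).
Proof.
have [E|E] := pselect (form v u = 0); first by rewrite E fstar0; apply/form0C.
set b := form v u in E *.
have bU : b \is a GRing.unit by apply/multiplier_unitE/eqP.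
(* The value -1 means orthogonality, which is symmetric. *)
have : form ((- b^-1) *: v) u = -1 by rewrite formZl mulNr mulVr.
move=> /form_perp/operp_sym/form_perp; rewrite formZr => /(congr1 ( *%R^~ (fstar b))).
by rewrite -mulrA -fstarM mulrN divrr // fstarN1 mulrN1 mulN1r => /oppr_inj.
Qed.

Lemma fstarK : involutive fstar.
Proof. by move=> a; have [x [v <-]] := form_surj a; rewrite -!form_sym. Qed.

End Form.

Definition multiplier_star_sfield (G : geometry) : star_sfield :=
  StarSfield (@multiplier_unitE G) (@fstarD G) (@fstarM G) (@fstarK G).

(** * The Hermitian space on [F * V] *)

Section Space.
Variable G : geometry.
Local Notation X := (carrier G).
Local Notation o := (origin G).
Local Notation V := (affine G).
Local Notation F := (multiplier_star_sfield G).

Definition hspace : lmodType F := (F^o * V)%type.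

Definition hspace_form (p q : hspace) : F := p.1 * fstar q.1 + form p.2 q.2.

Lemma hspace_form_linl (a b : F) (u v w : hspace) :
  hspace_form (a *: u + b *: v) w = a * hspace_form u w + b * hspace_form v w.
Proof.
rewrite /hspace_form /= formDl !formZl !mulrDr mulrDl !mulrA addrACA //.
Qed.

Lemma hspace_form_linr (a b : F) (u v w : hspace) :
  hspace_form w (a *: u + b *: v) = hspace_form w u * fstar a + hspace_form w v * fstar b.
Proof.
rewrite /hspace_form /= formDr !formZr !mulrDl fstarD !fstarM mulrDr !mulrA addrACA //.
Qed.

Lemma hspace_form_sym (u v : hspace) : hspace_form u v = fstar (hspace_form v u).
Proof. by rewrite /hspace_form fstarD fstarM fstarK -form_sym. Qed.

(** A vector with first coordinate 0 comes from a slope; any other scales to (1, w), and isotropy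
    would make the affine point [w] orthogonal to itself. *)
Lemma hspace_form_aniso (u : hspace) : hspace_form u u = 0 -> u = 0.
Proof.
case: u => a u; rewrite /hspace_form /= => E.
have [a0|a0] := pselect (a = 0).
  move: E; rewrite a0 mul0r add0r => /form_eq0/slope_perp/perpxx/slope_eq0 -> //.
have aU : (a : F) \is a GRing.unit by apply/multiplier_unitE/eqP.
have uE : u = a *: ((a : F)^-1 *: u) by rewrite scalerA divrr ?scale1r.
have fU : fstar a \is a GRing.unit.
  apply/multiplier_unitE/eqP => fa0; apply: a0.
  by rewrite -[a]fstarK fa0 fstar0.
move: E; rewrite uE; set w := _ *: u; rewrite formZl formZr => E.
have : (a : F) * (1 + form w w) * fstar a = 0 by rewrite mulrDr mulr1 mulrDl -mulrA.
move/(canRL (mulrK fU)); rewrite mul0r => /(canRL (mulKr aU)).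
rewrite mulr0 addrC => /eqP.
by rewrite addr_eq0 => /eqP/form_perp/perpxx/affine_proper.
Qed.

End Space.

Definition hermitian (G : geometry) : hermitian_space (multiplier_star_sfield G) :=
  @HermitianSpace (multiplier_star_sfield G) (hspace G) (@hspace_form G)
    (@hspace_form_linl G) (@hspace_form_linr G) (@hspace_form_sym G) (@hspace_form_aniso G).

(** * Homogeneous coordinates *)

Section Coordinates.
Variable G : geometry.
Local Notation X := (carrier G).
Local Notation o := (origin G).
Local Notation F := (multiplier_star_sfield G).
Local Notation H := (hermitian G).
Implicit Types (x y z : X) (u v w : H) (p q : affine G) (a b c : F).

Lemma slope_surj x : x _|_ o -> exists p, slope p = x.
Proof.
move=> xo; have [->|x0] := pselect (x = ozero); first by exists 0; exact: slope0.
have nx0 : x <> (0 : affine G) :> X.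
  by move=> E; apply: (@affineP _ (0 : affine G)); rewrite -E.
have [p [p0 Lp]] := affine_on_line x0 nx0.
by exists p; apply: dir_uniqueR => //; exact: nesym.
Qed.

(** At infinity the vector is determined only up to a nonzero scalar and is therefore chosen;
    [ozero] receives the zero vector. *)
Definition coord x : H :=
  match pselect (x _|_ o) with
  | left xo => (0, projT1 (cid (slope_surj xo)))
  | right xo => (1, exist _ x xo)
  end.

Lemma coordP x : (exists2 p : affine G, coord x = (0, p) & x = slope p) \/
  (exists2 p : affine G, coord x = (1, p) & x = p).
Proof.
rewrite /coord; case: pselect => xo; last by right; exists (exist _ x xo).
by left; case: cid => p /= px; exists p.
Qed.

Lemma coord_perp x y : x _|_ y <-> hperp (coord x) (coord y).
Proof.
rewrite /hperp; have [[p -> ->]|[p -> ->]] := coordP x;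
  have [[q -> ->]|[q -> ->]] := coordP y; rewrite /= /hspace_form /= ?mul0r ?add0r.
- by rewrite form_eq0 slope_perp.
- by rewrite form_eq0.
- by rewrite fstar0 mulr0 add0r perpC -form_eq0; split=> /form0C.
rewrite fstar1 mul1r addrC form_perp.
by split=> [->|/eqP]; rewrite ?addNr // addr_eq0 => /eqP.
Qed.

Lemma coord_surj v : exists x c, c != 0 /\ v = c *: coord x.
Proof.
case: v => a p; have [->|a0] := eqVneq a 0; last first.
  have aU := sfield_unit a0.
  pose p' : affine G := (a : multiplier G)^-1 *: p.
  exists p', a; split=> //.
  have [[q _ E]|[q -> /affine_inj <-]] := coordP p'.
    by case: (@affineP _ p'); rewrite E; exact: slope_orth.
  by congr pair => /=; [rewrite [RHS]mulr1|rewrite scalerA divrr ?scale1r].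
have [[q Eq pq]|[q _ E]] := coordP (slope p); last first.
  by case: (@affineP _ q); rewrite -E; exact: slope_orth.
exists (slope p); rewrite Eq; have [p0|p0] := pselect (p = 0).
  exists 1; split; first exact: oner_neq0.
  by move: pq; rewrite p0 slope0 => /esym/slope_eq0 ->; rewrite scale1r.
have q0 : q <> 0 by move=> q0; move: pq; rewrite q0 slope0 => /slope_eq0.
have [c /eqP c0 ->] := slope_eqP q0 p0 (esym pq).
by exists c; split=> //; congr pair => /=; rewrite [RHS]mulr0.
Qed.

Lemma hperpZ a b u v : a != 0 -> b != 0 -> hperp (a *: u) (b *: v) <-> hperp u v.
Proof.
move=> a0 b0; have aU := sfield_unit a0.
have bU : star b \is a GRing.unit.
  apply: sfield_unit; apply: contra b0 => /eqP E.
  by rewrite -[b]starK E star0.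
rewrite /hperp hformZl hformZr; split=> [/(canRL (mulKr aU))|->].
  by rewrite mulr0 => /(canRL (mulrK bU)); rewrite mul0r.
by rewrite mul0r mulr0.
Qed.

Lemma lineZ c u : c != 0 -> line (c *: u) = line u.
Proof.
move=> c0; have cU := sfield_unit c0; apply/seteqP; split=> _ [a _ <-].
  by rewrite scalerA; exists (a * c).
by exists (a * c^-1) => //; rewrite scalerA mulrVK.
Qed.

Lemma coord_line_in x : line (coord x) \in @lines F H.
Proof. by apply/mem_set; exists (coord x). Qed.

Definition coord_line x : projective_orthoset H := exist _ (line (coord x)) (coord_line_in x).

Lemma coord_line_perp x y : x _|_ y <-> coord_line x _|_ coord_line y.
Proof.
rewrite coord_perp; split=> [xy|[u [v [/= xu yv uv]]]].
  by exists (coord x), (coord y).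
exact: (@line_eq_perp F H u (coord x) v (coord y) (esym xu) (esym yv) uv).
Qed.

Lemma coord_line_iso : orthoisomorphism coord_line.
Proof.
split; last exact: coord_line_perp.
have inj : injective coord_line.
  move=> x y xy; have P z : x _|_ z <-> y _|_ z by rewrite !coord_line_perp xy.
  have [x0|x0] := pselect (x = ozero).
    by rewrite x0; apply/esym/perpxx/P; rewrite x0; exact: perp0x.
  have [y0|y0] := pselect (y = ozero).
    by rewrite y0; apply/perpxx/P; rewrite y0; exact: perp0x.
  apply: frechetG => // z /(_ _ erefl) zx _ ->.
  by apply/operp_sym/P/operp_sym.
have surj (S : projective_orthoset H) : exists x, coord_line x = S.
  case: S => S SP; have [v _ vS] := set_mem SP; have [x [c [c0 vx]]] := coord_surj v.
  by exists x; apply: val_inj => /=; rewrite -vS vx lineZ.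
exists (fun S => projT1 (cid (surj S))) => [x|S]; last by case: cid.
by case: cid => y /= /inj.
Qed.

(** The elements of [X] with coordinates in [S] form a subspace. Its projection provides a [w] in
    [S] to which the same vectors of [S] are orthogonal as to [v]. *)
Lemma space_orthomodular : orthomodular_space H.
Proof.
move=> S [[S0 Slin] Scl].
have SD a u v : S u -> S v -> S (a *: u + v).
  by move=> Su Sv; apply: set_mem; apply: Slin; exact/mem_set.
have S00 : S 0 by exact: set_mem S0.
have SZ a u : S u -> S (a *: u) by move=> Su; rewrite -[_ *: _]addr0; exact: SD.
split; last first.
  apply/seteqP; split=> [u [Su uS]|_ ->]; first exact/hform_aniso/uS.
  by split=> // v _; exact: hform0l.
pose A := [set x | S (coord x)].
have hA : subspace A.
  apply/seteqP; split=> x; first by move=> Ax y yA; exact/operp_sym/yA.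
  move=> xA; rewrite /A /= Scl => t tS; have [z [c [c0 tz]]] := coord_surj t.
  rewrite tz -[coord x]scale1r; apply/hperpZ => //; first exact: oner_neq0.
  apply/coord_perp/xA => a Aa; apply/coord_perp.
  apply/(hperpZ (coord z) (coord a) c0 (oner_neq0 F)).
  by rewrite scale1r -tz; exact: tS.
have proj_vec v : exists2 w, S w & forall s, S s -> (hperp s v <-> hperp s w).
  have [x [c [c0 ->]]] := coord_surj v; have [y Ay yP] := proj x hA.
  exists (coord y) => // s Ss; have [z [d [d0 sz]]] := coord_surj s.
  have Az : A z.
    have -> : A z = S (d^-1 *: s) by rewrite sz scalerA mulVr ?scale1r //; exact: sfield_unit.
    exact: SZ.
  rewrite sz hperpZ // -coord_perp yP // coord_perp.
  by rewrite -[coord y in X in _ <-> X]scale1r hperpZ // oner_neq0.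
move=> v; have [w Sw wP] := proj_vec v.
have [w0|w0] := pselect (w = 0).
  exists 0, v; split; rewrite ?add0r // => s /wP sw; apply/hperp_sym/sw.
  by rewrite w0; apply/hperp_sym; exact: hform0l.
set q := hform w w.
have qU : q \is a GRing.unit.
  by apply: sfield_unit; apply/eqP => /hform_aniso.
have starqV : star q^-1 = q^-1.
  have sq : star q = q by rewrite /q -hform_sym.
  apply: (mulrI qU); rewrite -{1}sq -starM mulVr // divrr //.
  have := starM (q^-1 * q) q; rewrite mulVr // mul1r sq => E.
  by apply: (mulrI qU); rewrite mulr1 -E.
(* [w] is known only up to a scalar; the component of [v] along [w] is the multiple required. *)
exists ((hform v w * q^-1) *: w), (v - (hform v w * q^-1) *: w).
split; first exact: SZ; last by rewrite addrC subrK.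
move=> s Ss; apply/hperp_sym; rewrite /hperp.
have Br (x y z : H) : hform x (y - z) = hform x y - hform x z.
  have := hform_linr (1 : F) (-1) y z x; rewrite scale1r scaleN1r => ->.
  by rewrite [star 1]fstar1 [star (-1)]fstarN1 mulr1 mulrN1.
have Bl (x y z : H) : hform (x - y) z = hform x z - hform y z.
  have := hform_linl (1 : F) (-1) x y z; rewrite scale1r scaleN1r => ->.
  by rewrite mul1r mulN1r.
rewrite Br hformZr starM starqV -hform_sym mulrA.
(* This vector of [S] is orthogonal to [w], hence to [v], which is the identity sought. *)
have : S (s - (hform s w * q^-1) *: w).
  by rewrite addrC -scaleNr; exact: SD.
move=> /wP [_ H1]; have : hperp (s - (hform s w * q^-1) *: w) v.
  by apply: H1; rewrite /hperp Bl hformZl -/q mulrVK // subrr.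
by rewrite /hperp Bl hformZl.
Qed.

(** [X] and the lines of [H] have the same orthogonal families, so the countability convention for
    [H] is inherited from [X]. Distinct orthogonal vectors have distinct points, since a shared
    point would be self-orthogonal and both vectors zero. *)
Lemma space_countable : countable_orthogonality (@operp X) ->
  countable_orthogonality (@hperp F H).
Proof.
move=> cX A Ao; pose g v := projT1 (cid (coord_surj v)).
have gP v : exists c, c != 0 /\ v = c *: coord (g v) by rewrite /g; case: cid.
have gperp u v : hperp u v -> g u _|_ g v.
  have [a [a0 ua]] := gP u; have [b [b0 vb]] := gP v.
  by rewrite {1}ua {1}vb hperpZ // -coord_perp.
have ginj : {in A &, injective g}.
  move=> u v /set_mem Au /set_mem Av guv; apply: contrapT => uv.
  have := gperp _ _ (Ao _ _ Au Av uv); rewrite guv => /coord_perp/hform_aniso gv0.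
  have [a [_ ua]] := gP u; have [b [_ vb]] := gP v.
  by apply: uv; rewrite ua vb guv gv0 !scaler0.
rewrite /countable -(card_le_eql (inj_card_eq ginj)); apply: cX.
move=> _ _ [u Au <-] [v Av <-] guv; apply: gperp; apply: Ao => // uv.
by apply: guv; rewrite uv.
Qed.

End Coordinates.

Theorem theorem5p8 (X : orthoset)
    (hirr : irreducible X)
    (hfre : frechet X)
    (hrank : rank_at_least 4 X)
    (hadj : forall (A : set X) (hA : subspace A), adjointable (inclusion hA)) :
  exists (F : star_sfield) (H : hermitian_space F),
    [/\ orthomodular_space H,
        exists f : X -> projective_orthoset H, orthoisomorphism f
      & countable_orthogonality (@operp X) -> countable_orthogonality (@hperp F H)].
Proof.
have [o o0] := @proper_exists X 4 erefl hrank.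
pose G := Geometry o0 hfre hadj hirr hrank.
exists (multiplier_star_sfield G), (hermitian G); split.
- exact: space_orthomodular.
- by exists (@coord_line G); exact: coord_line_iso.
- exact: (@space_countable G).
Qed.
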